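(* Let $(X_n)_{n\ge 1}$ be a stationary sequence of associated real-valued random variables with common distribution function $F$ and finite second moment, and let $0<p<1$. Suppose that: (C.1) (i) $X_1$ has a bounded probability density function $f$; (ii) in a neighborhood of $x_p$, $F$ possesses a bounded second derivative $F''$; (C.2) there exist constants $a_0\ge 0$ and $a>0$ such that $\mathrm{Cov}(X_1,X_{k+1})\le a_0\exp(-ak)$ for all $k\ge 1$. If $f(x_p)>0$, then there exists a constant $C$ not depending on $n$ such that, for all large enough $n$, $$\sup_{t\in\mathbb{R}}\left|P\left(\frac{\sqrt{n}\,\big(F_n^{-1}(p)-F^{-1}(p)\big)}{a_p}\le t\right)-\Phi(t)\right|\le C\,n^{-1/2}\log^2 n,$$ where $a_p:=\sigma(x_p)/f(x_p)$ and $\Phi$ is the distribution function of a standard normal variable.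
   Context: A sequence $(X_n)_{n\ge1}$ of real-valued random variables is associated if, for every finite subcollection $X_{i_1},\ldots,X_{i_n}$ and every pair of coordinatewise nondecreasing functions $g,h:\mathbb{R}^n\to\mathbb{R}$, $\mathrm{Cov}\big(g(X_{i_1},\ldots,X_{i_n}),h(X_{i_1},\ldots,X_{i_n})\big)\ge 0$ whenever the covariance is defined. Stationary means strictly stationary (all finite-dimensional distributions are shift-invariant). $I(A)$ denotes the indicator function of a set $A$. For $0<p<1$, $x_p:=F^{-1}(p)=\inf\{x: F(x)\ge p\}$ is the $p$th quantile of $F$. The empirical distribution function is $F_n(x)=n^{-1}\sum_{i=1}^n I(X_i\le x)$, $x\in\mathbb{R}$, and the sample $p$th quantile is $F_n^{-1}(p)=\inf\{x: F_n(x)\ge p\}$. Near $x_p$, where $F$ is differentiable, $f$ is taken to be $F'$; in particular $f(x_p)=F'(x_p)$. $$\sigma^2(x_p):=\mathrm{Var}\big(I(X_1\le x_p)\big)+2\sum_{j=2}^{\infty}\mathrm{Cov}\big(I(X_1\le x_p),I(X_j\le x_p)\big),$$ and $\sigma(x_p)\ge 0$ is its square root. $\log^2 n$ means $(\log n)^2$. *)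

(* Defs.v *)
From HB Require Import structures.
From mathcomp Require Import all_boot all_order all_algebra.
From mathcomp Require Import all_classical all_reals all_analysis.

Set Implicit Arguments.
Unset Strict Implicit.
Unset Printing Implicit Defensive.
Import Order.TTheory GRing.Theory Num.Theory.
Import numFieldNormedType.Exports.
Local Open Scope classical_set_scope.
Local Open Scope ring_scope.

(* Sequences are indexed from 0: [X i] stands for the variable usually written
   X_(i+1). Thus the sample of size n is X 0, ..., X n.-1, and a sum over
   j >= 2 of terms in (X_1, X_j) becomes a sum over j >= 1 of terms in
   (X 0, X j). *)

(* Equality of the laws of (X_(i_1), ..., X_(i_n)) and of its shift by k, on
   the product sigma-algebra of R^n. *)
Definition strictly_stationary (d : measure_display) (T : measurableType d)
    (R : realType) (P : probability T R) (X : nat -> {RV P >-> R}) : Prop :=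
  forall (n : nat) (i : 'I_n -> nat) (k : nat) (B : set (n.-tuple R)),
    measurable B ->
    P ((fun w => [tuple X (i j + k)%N w | j < n]) @^-1` B) =
    P ((fun w => [tuple X (i j) w | j < n]) @^-1` B).

Definition coord_nondecreasing (R : realType) (n : nat) (g : n.-tuple R -> R)
    : Prop :=
  forall u v : n.-tuple R, (forall j, tnth u j <= tnth v j) -> g u <= g v.

(* Monotone functions of several variables need not be Borel. The covariance
   of Y and Z is taken to be defined when Y, Z and Y * Z are integrable, which
   includes their measurability. *)
Definition covariance_defined (d : measure_display) (T : measurableType d)
    (R : realType) (P : probability T R) (Y Z : T -> R) : Prop :=
  [/\ Y \in Lfun P 1, Z \in Lfun P 1 & Y * Z \in Lfun P 1].

Definition associated (d : measure_display) (T : measurableType d)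
    (R : realType) (P : probability T R) (X : nat -> {RV P >-> R}) : Prop :=
  forall (n : nat) (i : 'I_n -> nat) (g h : n.-tuple R -> R),
    injective i -> coord_nondecreasing g -> coord_nondecreasing h ->
    let gX := fun w => g [tuple X (i j) w | j < n] in
    let hX := fun w => h [tuple X (i j) w | j < n] in
    covariance_defined P gX hX ->
    (0 <= covariance P gX hX)%E.

Definition distr_fun (d : measure_display) (T : measurableType d)
    (R : realType) (P : probability T R) (Y : {RV P >-> R}) (x : R) : R :=
  fine (cdf Y x).

Definition is_density (d : measure_display) (T : measurableType d)
    (R : realType) (P : probability T R) (Y : {RV P >-> R}) (f : R -> R)
    : Prop :=
  [/\ measurable_fun setT f, forall x, 0 <= f x &
      forall A : set R, measurable A ->
        distribution P Y A = (\int[lebesgue_measure]_(x in A) (f x)%:E)%E].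

Definition bounded_second_derivative_near (R : realType) (F : R -> R) (x0 : R)
    : Prop :=
  exists M : R, \forall x \near x0,
    [/\ derivable F x 1, derivable F^`()%classic x 1 & `|F^`(2)%classic x| <= M].

Definition quantile (R : realType) (F : R -> R) (p : R) : R :=
  inf [set x | p <= F x].

Definition ind_le (d : measure_display) (T : measurableType d)
    (R : realType) (P : probability T R) (Y : {RV P >-> R}) (x : R) : T -> R :=
  \1_[set w | Y w <= x].

Definition empirical_distr_fun (d : measure_display) (T : measurableType d)
    (R : realType) (P : probability T R) (X : nat -> {RV P >-> R}) (n : nat)
    (w : T) (x : R) : R :=
  n%:R^-1 * \sum_(i < n) ind_le (X i) x w.

Definition sample_quantile (d : measure_display) (T : measurableType d)
    (R : realType) (P : probability T R) (X : nat -> {RV P >-> R}) (n : nat)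
    (p : R) (w : T) : R :=
  quantile (empirical_distr_fun X n w) p.

Definition sigma2 (d : measure_display) (T : measurableType d)
    (R : realType) (P : probability T R) (X : nat -> {RV P >-> R}) (x : R)
    : \bar R :=
  ('V_P[ind_le (X 0%N) x] +
   2%:E * \sum_(1 <= j <oo) covariance P (ind_le (X 0%N) x) (ind_le (X j) x))%E.

(* For an associated sequence with a bounded density and exponentially decaying
   covariances, [sigma2] is finite, so that [fine] loses nothing. *)
Definition sigma (d : measure_display) (T : measurableType d)
    (R : realType) (P : probability T R) (X : nat -> {RV P >-> R}) (x : R)
    : R :=
  Num.sqrt (fine (sigma2 X x)).

Definition Phi (R : realType) (t : R) : \bar R :=
  normal_prob (0 : R) 1 `]-oo, t].

(* Main.v *)
Require Import Defs.
From HB Require Import structures.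
From mathcomp Require Import all_boot all_order all_algebra.
From mathcomp Require Import all_classical all_reals all_analysis.
From mathcomp Require Import measurable_realfun ring lra zify.

Set Implicit Arguments.
Unset Strict Implicit.
Unset Printing Implicit Defensive.
Import Order.TTheory GRing.Theory Num.Theory.
Import numFieldNormedType.Exports.
Local Open Scope classical_set_scope.
Local Open Scope ring_scope.

(** The sample quantile is at most [x] exactly when at most [n (1 - p)]
observations exceed [x].  So the theorem is a Berry-Esseen bound, uniform for
[x] near the quantile, for the number of exceedances, followed by a comparison
of the normal laws obtained at the different points [x].

The exceedance bits [x < X i] are nondecreasing functions of the observations,
hence associated ([exceed_law_assoc]).  Their covariances decay geometrically:
smoothing the indicator at scale [e] costs [O(e)] because the density is
bounded, and multiplies the covariance of the observations by at most [e ^- 2];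
the best [e] gives the rate ([ind_cov_smoothing], [ind_cov_decay]).

The Berry-Esseen bound is proved by Stein's method on the finite law of [n]
bits.  Let [W] be the standardized sum of the bits, [h] the distance between
consecutive values of [W], and [M i] the number of ones at distance at most [m]
from the index [i].  In the expectation of [(bit i - E (bit i)) * f W] the value
[f W] may be replaced by [f (W - h M i)] at the price of the same expectation
with the neighbours of [i] removed, which is negligible because distant bits are
nearly uncorrelated ([punctured_cov]).  The difference [f W - f (W - h M i)]
telescopes into steps of length [h]; the step number [k] is taken when
[k < M i].  Summing over [i], the step number [k] receives the random weight
[sum_i (bit i - E (bit i)) * (k < M i)].  This weight has small variance
([var_kernel_le]), so it can be replaced by its mean ([stein_identity]), and its
mean is nonnegative, because a bit and a count of bits are both nondecreasing
([kernel_mass_ge0]).  This positivity keeps the argument short: a clipped linear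
[f] has nonnegative steps, so the identity bounds the probability of a short
interval at once ([concentration]), and with that bound the solution of Stein's
equation gives the distance to the normal law ([stein_approximation]).  The
weights are discontinuous in the observations, but on the cube every bounded
function is Lipschitz ([dominated_bounded]), so the covariance inequality of
associated variables ([cov_dominated]) applies to them.  A window [m]
proportional to [ln n] makes the distant covariances negligible and leaves an
error of order [m ^+ 2 / sqrt n].

It remains to vary the point.  For [|t| <= sqrt (ln n)] the point
[x = x_p + t * a_p / sqrt n] is close to [x_p], the variance of the count at [x]
divided by [n] differs from [sigma2] by [O(ln n * |x - x_p| + 1 / n)]
([count_variance_dist]), and a second-order expansion of the distribution
function shows that the argument of the normal distribution function differs
from [t] by [O((ln n) ^+ 2 / sqrt n)] ([local_approx]).  For larger [|t|]
monotonicity and the Gaussian tail suffice ([uniform_rate]). *)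


(** * Expectations under a law on a finite type *)

Section FiniteExpectation.
Variables (R : realType) (Om : finType) (mu : Om -> R).
Implicit Types G H K : Om -> R.

Definition Ex G : R := \sum_b mu b * G b.
Definition cov G H : R := Ex (fun b => G b * H b) - Ex G * Ex H.

Lemma eq_Ex G H : G =1 H -> Ex G = Ex H.
Proof. by move=> e; apply: eq_bigr => b _; rewrite e. Qed.

Lemma ExD G H : Ex (fun b => G b + H b) = Ex G + Ex H.
Proof. by rewrite /Ex -big_split; apply: eq_bigr => b _; rewrite mulrDr. Qed.

Lemma ExZ c G : Ex (fun b => c * G b) = c * Ex G.
Proof. by rewrite /Ex mulr_sumr; apply: eq_bigr => b _; rewrite mulrCA. Qed.

Lemma ExB G H : Ex (fun b => G b - H b) = Ex G - Ex H.
Proof. by rewrite /Ex -sumrB; apply: eq_bigr => b _; rewrite mulrBr. Qed.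

Lemma Ex_sum (J : Type) (r : seq J) (Q : pred J) (F : J -> Om -> R) :
  Ex (fun b => \sum_(j <- r | Q j) F j b) = \sum_(j <- r | Q j) Ex (F j).
Proof.
rewrite /Ex exchange_big /=; apply: eq_bigr => b _.
by rewrite mulr_sumr.
Qed.

Lemma eq_cov G G' H H' : G =1 G' -> H =1 H' -> cov G H = cov G' H'.
Proof.
move=> eG eH; rewrite /cov (eq_Ex eG) (eq_Ex eH).
by congr (_ - _); apply: eq_Ex => b; rewrite eG eH.
Qed.

Lemma covC G H : cov G H = cov H G.
Proof.
by rewrite /cov [Ex G * _]mulrC; congr (_ - _); apply: eq_Ex => b; rewrite mulrC.
Qed.

Lemma covDl G H K : cov (fun b => G b + H b) K = cov G K + cov H K.
Proof.
rewrite /cov ExD (@eq_Ex _ (fun b => G b * K b + H b * K b)) ?ExD; first by ring.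
by move=> b; rewrite mulrDl.
Qed.

Lemma covZl c G K : cov (fun b => c * G b) K = c * cov G K.
Proof.
rewrite /cov ExZ (@eq_Ex _ (fun b => c * (G b * K b))) ?ExZ; first by ring.
by move=> b; rewrite mulrA.
Qed.

Lemma cov_suml (J : Type) (r : seq J) (Q : pred J) (F : J -> Om -> R) K :
  cov (fun b => \sum_(j <- r | Q j) F j b) K = \sum_(j <- r | Q j) cov (F j) K.
Proof.
rewrite /cov sumrB -Ex_sum Ex_sum mulr_suml; congr (_ - _).
by apply: eq_Ex => b; rewrite mulr_suml.
Qed.

Lemma cov_sumr (J : Type) (r : seq J) (Q : pred J) (F : J -> Om -> R) K :
  cov K (fun b => \sum_(j <- r | Q j) F j b) = \sum_(j <- r | Q j) cov K (F j).
Proof. by rewrite covC cov_suml; apply: eq_bigr => j _; rewrite covC. Qed.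

Lemma cov_centerl G H : Ex (fun b => (G b - Ex G) * H b) = cov G H.
Proof.
rewrite (@eq_Ex _ (fun b => G b * H b - Ex G * H b)) ?ExB ?ExZ//.
by move=> b; rewrite mulrBl.
Qed.

Definition is_law := (forall b, 0 <= mu b) /\ \sum_b mu b = 1.
Hypothesis lawmu : is_law.

Lemma Ex_cst c : Ex (fun=> c) = c.
Proof. by rewrite /Ex -mulr_suml lawmu.2 mul1r. Qed.

Lemma Ex_le G H : (forall b, G b <= H b) -> Ex G <= Ex H.
Proof. by move=> le; apply: ler_sum => b _; rewrite ler_wpM2l ?lawmu.1. Qed.

Lemma Ex_ge0 G : (forall b, 0 <= G b) -> 0 <= Ex G.
Proof. by move=> /Ex_le; rewrite Ex_cst. Qed.

Lemma Ex_norm G : `|Ex G| <= Ex (fun b => `|G b|).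
Proof.
apply: (le_trans (ler_norm_sum _ _ _)); apply: ler_sum => b _.
by rewrite normrM ger0_norm// lawmu.1.
Qed.

Lemma Ex_norm_le c G : (forall b, `|G b| <= c) -> `|Ex G| <= c.
Proof.
by move=> le; rewrite (le_trans (Ex_norm G))// -[leRHS]Ex_cst Ex_le.
Qed.

Lemma covBcl G c H : cov (fun b => G b - c) H = cov G H.
Proof.
rewrite -!cov_centerl; apply: eq_Ex => b; rewrite ExB Ex_cst; ring.
Qed.

Lemma cov_norm_le2 G H :
  (forall b, `|G b| <= 1) -> (forall b, `|H b| <= 1) -> `|cov G H| <= 2.
Proof.
move=> G1 H1; rewrite /cov.
have h : `|Ex G * Ex H| <= 1.
  by rewrite normrM mulr_ile1 ?Ex_norm_le.
have h2 : `|Ex (fun b => G b * H b)| <= 1.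
  by apply: Ex_norm_le => b; rewrite normrM mulr_ile1.
by rewrite (le_trans (ler_normB _ _))//; lra.
Qed.

(** The arithmetic-geometric form of the Cauchy-Schwarz inequality. *)
Lemma Ex_norm_center G (t : R) : 0 < t ->
  Ex (fun b => `|G b - Ex G|) <= (cov G G / t + t) / 2.
Proof.
move=> t0.
have -> : (cov G G / t + t) / 2 =
    Ex (fun b => ((G b - Ex G) ^+ 2 / t + t) / 2).
  have -> : cov G G = Ex (fun b => (G b - Ex G) ^+ 2).
    rewrite -(covBcl G (Ex G)) covC -cov_centerl.
    by apply: eq_Ex => b; rewrite expr2.
  rewrite (@eq_Ex (fun b => ((G b - Ex G) ^+ 2 / t + t) / 2)
    (fun b => (2 * t)^-1 * (G b - Ex G) ^+ 2 + t / 2)).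
    rewrite ExD Ex_cst ExZ; move: (Ex _) => v.
    by field; rewrite gt_eqF.
  by move=> b; field; rewrite gt_eqF.
apply: Ex_le => b; set y := _ - _.
rewrite ler_pdivlMr// -(@ler_pM2r _ t)// mulrDl mulfVK ?gt_eqF//.
rewrite -(real_normK (num_real y)).
have := sqr_ge0 (`|y| - t); nra.
Qed.

End FiniteExpectation.

(** * Associated binary vectors *)

Section BinaryVectors.
Variables (R : realType) (n : nat).
Notation Om := {ffun 'I_n -> bool}.
Variable mu : Om -> R.
Implicit Types (G H U V : Om -> R) (A : pred 'I_n).

Definition bit (i : 'I_n) (b : Om) : R := (b i)%:R.

Definition nondec G := forall a b : Om, (forall i, a i ==> b i) -> G a <= G b.

Definition assoc := forall G H, nondec G -> nondec H -> 0 <= cov mu G H.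

Lemma nondecD G H : nondec G -> nondec H -> nondec (fun b => G b + H b).
Proof. by move=> nG nH a b ab; rewrite lerD ?nG ?nH. Qed.

Lemma nondec_bit i : nondec (bit i).
Proof.
move=> a b /(_ i); rewrite /bit.
by case: (a i); case: (b i) => //=; rewrite ?ler01.
Qed.

Hypothesis assocmu : assoc.

Lemma cov_bit_ge0 i j : 0 <= cov mu (bit i) (bit j).
Proof. by apply: assocmu; exact: nondec_bit. Qed.

Definition dominated G U :=
  nondec (fun b => U b + G b) /\ nondec (fun b => U b - G b).

(** A function that becomes nondecreasing after adding it to [U] or subtracting
it from [U] inherits the decorrelation of [U].  Association makes the covariances
of [U + G] with [V + H] and of [U - G] with [V - H] nonnegative; in their sum the
mixed terms cancel and the lower bound on [cov G H] is left.  Changing the sign of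
[H] gives the upper bound. *)
Lemma cov_dominated G H U V : dominated G U -> dominated H V ->
  `|cov mu G H| <= cov mu U V.
Proof.
move=> [G1 G2] [H1 H2].
have e1 : cov mu (fun b => U b + G b) (fun b => V b + H b) =
    cov mu U V + cov mu G V + (cov mu U H + cov mu G H).
  by rewrite covDl !(covC _ _ (fun b => V b + H b)) !covDl
    !(covC _ V) !(covC _ H); ring.
have e2 c1 c2 : cov mu (fun b => U b + c1 * G b) (fun b => V b + c2 * H b) =
    cov mu U V + c1 * cov mu G V + (c2 * cov mu U H + c1 * c2 * cov mu G H).
  by rewrite covDl !(covC _ _ (fun b => V b + c2 * H b)) !covDl !covZl
    !(covC _ _ (fun b => c1 * G b)) !covZl !(covC _ V) !(covC _ H); ring.
have nN K L : nondec (fun b => K b - L b) ->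
    nondec (fun b => K b + -1 * L b).
  by move=> nKL a b ab; rewrite !mulN1r; exact: nKL.
have nP K L : nondec (fun b => K b + L b) ->
    nondec (fun b => K b + 1 * L b).
  by move=> nKL a b ab; rewrite !mul1r; exact: nKL.
have pp := assocmu (nP _ _ G1) (nP _ _ H1).
have nn := assocmu (nN _ _ G2) (nN _ _ H2).
have pn := assocmu (nP _ _ G1) (nN _ _ H2).
have np := assocmu (nN _ _ G2) (nP _ _ H1).
rewrite !e2 in pp nn pn np.
rewrite ler_norml; lra.
Qed.

Lemma dominated_bit i : dominated (bit i) (bit i).
Proof.
split; first by apply: nondecD; exact: nondec_bit.
by move=> a b _; rewrite !subrr.
Qed.

(** On the cube a bounded function is Lipschitz for free: two distinct
comparable points differ in some coordinate by a full unit. *)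
Lemma dominated_bounded A G (c : R) :
  (forall b, `|G b| <= c) ->
  (forall a b : Om, (forall i, A i -> a i = b i) -> G a = G b) ->
  dominated G (fun b => \sum_(i | A i) 2 * c * bit i b).
Proof.
move=> Gc GA.
have c0 : 0 <= c by rewrite (le_trans _ (Gc [ffun=> true])).
have key (a b : Om) : (forall i, a i ==> b i) ->
    `|G b - G a| <= \sum_(i | A i) 2 * c * bit i b -
                    \sum_(i | A i) 2 * c * bit i a.
  move=> ab; rewrite -sumrB.
  have ge0 i : 0 <= 2 * c * bit i b - 2 * c * bit i a.
    rewrite -mulrBr mulr_ge0 ?mulr_ge0// subr_ge0.
    exact: nondec_bit.
  case: (boolP [exists i, A i && (a i != b i)]) => [/existsP[i /andP[Ai ne]]|].
    rewrite (bigD1 i)//=.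
    have -> : 2 * c * bit i b - 2 * c * bit i a = 2 * c.
      move: ne (ab i); rewrite /bit; case: (a i); case: (b i) => //= _ _.
      by rewrite mulr1 mulr0 subr0.
    rewrite -[leLHS]addr0 lerD ?sumr_ge0//.
    rewrite (le_trans (ler_normB _ _))//.
    have := Gc a; have := Gc b; lra.
  rewrite negb_exists => /forallP ne.
  rewrite (GA b a) ?subrr ?normr0 ?sumr_ge0// => i Ai.
  by have := ne i; rewrite Ai/= negbK => /eqP.
by split=> a b /key; rewrite ler_norml; lra.
Qed.

End BinaryVectors.

(** * Stein's identity for associated bits *)

Definition within (n m : nat) (i j : 'I_n) : bool :=
  (i <= j + m)%N && (j <= i + m)%N.

Lemma card_within n m (i : 'I_n) : (#|[pred j | within m i j]| <= (2 * m).+1)%N.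
Proof.
pose g (j : 'I_n) : 'I_(2 * m).+1 := inord (j + m - i).
rewrite -(card_ord (2 * m).+1) -(@card_in_image _ _ g [pred j | within m i j]).
  exact: max_card.
move=> j k; rewrite !inE /within => /andP[j1 j2] /andP[k1 k2].
move=> /(congr1 (@nat_of_ord _)).
rewrite /g !inordK; [|lia|lia]; move=> e; apply: val_inj => /=; lia.
Qed.

Lemma sum_within_le (R : realType) n m (i : 'I_n) (F : 'I_n -> R) (c : R) :
  (forall j, within m i j -> F j <= c) -> 0 <= c ->
  \sum_(j | within m i j) F j <= (2 * m).+1%:R * c.
Proof.
move=> Fc c0; apply: (@le_trans _ _ (\sum_(j | within m i j) c)).
  exact: ler_sum.
rewrite sumr_const -[_ *+ _]mulr_natl ler_wpM2r// ler_nat.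
exact: card_within.
Qed.

Lemma sum_ord_le (R : realType) n (A : pred 'I_n) (F : 'I_n -> R) (c : R) :
  (forall j, A j -> F j <= c) -> 0 <= c -> \sum_(j | A j) F j <= n%:R * c.
Proof.
move=> Fc c0; apply: (@le_trans _ _ (\sum_(j | A j) c)); first exact: ler_sum.
rewrite sumr_const -[_ *+ _]mulr_natl ler_wpM2r// ler_nat.
by rewrite -[leqRHS]card_ord max_card.
Qed.

(** Decomposing over a fixed range of [k], with the number of steps in the
indicator, allows [N] to be random. *)
Lemma telescope_steps (R : realType) (f : R -> R) (h w : R) (N L : nat) :
  (N <= L)%N ->
  f w = f (w - h * N%:R) +
    \sum_(k < L) (k < N)%N%:R * (f (w - h * k%:R) - f (w - h * k.+1%:R)).
Proof.
move=> NL.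
have -> : \sum_(k < L) (k < N)%N%:R * (f (w - h * k%:R) - f (w - h * k.+1%:R)) =
   \sum_(k < N) (f (w - h * k%:R) - f (w - h * k.+1%:R)).
  rewrite (big_ord_widen L (fun k => f (w - h * k%:R) - f (w - h * k.+1%:R)))//.
  rewrite [RHS]big_mkcond; apply: eq_bigr => k _.
  by case: (k < N)%N; rewrite (mul1r, mul0r).
elim: N {NL} => [|N IH]; first by rewrite big_ord0 mulr0 subr0 addr0.
by rewrite big_ord_recr/= {1}IH; ring.
Qed.

Section SteinIdentity.
Variables (R : realType) (n m : nat).
Notation Om := {ffun 'I_n -> bool}.
Variables (mu : Om -> R) (h rho : R).
Hypotheses (lawmu : is_law mu) (assocmu : assoc mu).
Hypotheses (h_gt0 : 0 < h) (rho_ge0 : 0 <= rho) (n_gt0 : (0 < n)%N).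
Hypothesis cov_far : forall i j : 'I_n, ~~ within m i j ->
  cov mu (bit R i) (bit R j) <= rho.
Let L : nat := (2 * m).+1.
Hypothesis rho_small : n%:R ^+ 2 * L%:R ^+ 2 * rho <= 1.
Hypothesis unit_variance :
  h ^+ 2 * (\sum_i \sum_j cov mu (bit R i) (bit R j)) = 1.

Local Notation E := (Ex mu).
Local Notation bit := (bit R).

Definition stdsum (b : Om) : R := h * \sum_i (bit i b - E (bit i)).
Local Notation W := stdsum.
Definition local_count (i : 'I_n) (b : Om) : nat := \sum_(j | within m i j) b j.
Local Notation M := local_count.
Definition step (f : R -> R) (k : nat) (w : R) : R :=
  f (w - h * k%:R) - f (w - h * k.+1%:R).
(** The random weight of the step number [k] in Stein's identity: bit [i]
contributes when at least [k + 1] of its neighbours equal one. *)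
Definition kernel_fun (k : nat) (b : Om) : R :=
  \sum_i (bit i b - E (bit i)) * (k < M i b)%N%:R.
Local Notation T := kernel_fun.
Definition kernel_mass (k : nat) : R := E (T k).
Local Notation K := kernel_mass.

Lemma local_count_le i b : (M i b <= L)%N.
Proof.
apply: leq_trans (card_within m i); rewrite -sum1_card.
by apply: leq_sum => j _; case: (b j).
Qed.

Lemma local_countE i b : (M i b)%:R = \sum_(j | within m i j) bit j b :> R.
Proof. by rewrite /M natr_sum. Qed.

Lemma bit_center_norm i b : `|bit i b - E (bit i)| <= 1.
Proof.
have b01 a : 0 <= bit i a <= 1 by rewrite /bit; case: (a i); rewrite ?ler01 ?lexx.
have : 0 <= E (bit i) by apply: Ex_ge0 => // a; case/andP: (b01 a).
have : E (bit i) <= 1.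
  by rewrite -(Ex_cst lawmu 1); apply: Ex_le => // a; case/andP: (b01 a).
have := b01 b; rewrite ler_norml; lra.
Qed.

Lemma nondec_count_gt i (k : nat) : nondec (fun b => (k < M i b)%N%:R : R).
Proof.
move=> a b ab; rewrite ler_nat.
have : (M i a <= M i b)%N.
  by apply: leq_sum => j _; move: (ab j); case: (a j); case: (b j).
by move=> Mab; case: ltnP => // kMa; rewrite (leq_trans kMa Mab).
Qed.

(** The kernel is positive: each bit and each count exceeding a level are both
nondecreasing, so association applies to their covariance. *)
Lemma kernel_mass_ge0 k : 0 <= K k.
Proof.
rewrite /K /T Ex_sum; apply: sumr_ge0 => i _.
rewrite cov_centerl; apply: assocmu; first exact: nondec_bit.
exact: nondec_count_gt.
Qed.

Lemma sum_kernel_mass : \sum_(k < L) K k =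
  \sum_i \sum_(j | within m i j) cov mu (bit i) (bit j).
Proof.
rewrite /K /T; under eq_bigr do rewrite Ex_sum.
rewrite exchange_big/=; apply: eq_bigr => i _.
under eq_bigr do rewrite cov_centerl.
rewrite -cov_sumr -cov_sumr; apply: eq_cov => // b.
rewrite -local_countE.
(* counting levels is the telescoping of the identity function *)
have := @telescope_steps R id 1 0 _ _ (local_count_le i b).
move=> /=. rewrite mul1r sub0r => /esym /eqP; rewrite addrC subr_eq0 => /eqP <-.
by apply: eq_bigr => k _; rewrite -natr1; ring.
Qed.

Lemma far_sum_le (i : 'I_n) :
  \sum_(j | ~~ within m i j) cov mu (bit i) (bit j) <= n%:R * rho.
Proof. by apply: sum_ord_le => // j; exact: cov_far. Qed.

Lemma n2rho : n%:R ^+ 2 * rho <= 1.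
Proof.
apply: le_trans rho_small; rewrite ler_wpM2r//.
rewrite -[leLHS]mulr1 ler_wpM2l ?exprn_ge0// exprn_ege1//.
by rewrite ler1n.
Qed.

Definition total_mass : R := h ^+ 2 * \sum_(k < L) K k.
Local Notation S := total_mass.

Lemma total_mass_le1 : S <= 1.
Proof.
rewrite /S -unit_variance sum_kernel_mass ler_wpM2l ?sqr_ge0//.
apply: ler_sum => i _; rewrite [leRHS](bigID (within m i))/= lerDl.
by apply: sumr_ge0 => j _; exact: cov_bit_ge0.
Qed.

(** The kernel carries the near-diagonal part of the unit variance; the rest is
a sum of [n ^+ 2] covariances that are at most [rho]. *)
Lemma total_mass_ge : 1 - h ^+ 2 <= S.
Proof.
have h2 : 0 <= h ^+ 2 by exact: sqr_ge0.
rewrite lerBlDr /S -unit_variance sum_kernel_mass.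
rewrite -[X in _ + X]mulr1 -mulrDr ler_wpM2l//.
apply: (@le_trans _ _ (\sum_i \sum_(j | within m i j) cov mu (bit i) (bit j)
   + n%:R ^+ 2 * rho)); last by rewrite lerD2l n2rho.
rewrite -lerBlDl -sumrB.
under eq_bigr => i _ do rewrite (bigID (within m i))/= addrAC subrr add0r.
apply: (@le_trans _ _ (\sum_(i < n) n%:R * rho)).
  by apply: ler_sum => i _; exact: far_sum_le.
by rewrite sumr_const card_ord -[_ *+ _]mulr_natl; lra.
Qed.

Lemma kernel_term_norm i k b :
  `|(bit i b - E (bit i)) * (k < M i b)%N%:R| <= 1.
Proof.
rewrite normrM mulr_ile1// ?bit_center_norm//.
by case: (k < _)%N; rewrite ?normr1 ?normr0.
Qed.

Lemma kernel_term_dominated i k :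
  dominated (fun b => (bit i b - E (bit i)) * (k < M i b)%N%:R)
    (fun b => \sum_(j | within m i j) 2 * 1 * bit j b).
Proof.
apply: dominated_bounded; first exact: kernel_term_norm.
move=> a b ab; rewrite /bit (ab i); last by rewrite /within leq_addr.
by rewrite /M; under eq_bigr => j ij do rewrite (ab j ij).
Qed.

(** The terms [i] and [j] depend only on bits within [m] of [i] and of [j], which
are distant from one another as soon as [i] and [j] are more than [3 m] apart.
The remaining pairs are at most [n * (6 m + 1)], with covariances at most 2. *)
Lemma var_kernel_le k : cov mu (T k) (T k) <= 10 * n%:R * L%:R.
Proof.
rewrite /T cov_suml.
pose t i b : R := (bit i b - E (bit i)) * (k < M i b)%N%:R.
have nearle i j : cov mu (t i) (t j) <= 2.
  rewrite (le_trans (ler_norm _))// cov_norm_le2// => b; exact: kernel_term_norm.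
have farle i j : ~~ within (3 * m) i j ->
    cov mu (t i) (t j) <= 4 * L%:R ^+ 2 * rho.
  move=> ij; rewrite (le_trans (ler_norm _))//.
  rewrite (le_trans (cov_dominated assocmu (kernel_term_dominated i k)
    (kernel_term_dominated j k)))//.
  rewrite cov_suml.
  rewrite (_ : 4 * _ * _ = L%:R * (L%:R * (4 * rho))); last by ring.
  apply: sum_within_le => [i' ii'|]; last by rewrite !mulr_ge0.
  rewrite cov_sumr; apply: sum_within_le => [j' jj'|]; last by rewrite mulr_ge0.
  rewrite covZl covC covZl mulr1 mulrA -natrM ler_wpM2l//.
  rewrite covC; apply: cov_far; move: ij ii' jj'; rewrite /within; lia.
have bound i : cov mu (t i) (fun b => \sum_j t j b) <=
    6 * L%:R + n%:R * (4 * L%:R ^+ 2 * rho).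
  rewrite cov_sumr (bigID (within (3 * m) i))/= lerD//.
    apply: le_trans (_ : (2 * (3 * m)).+1%:R * 2 <= _); last first.
      by rewrite -!natrM ler_nat /L; lia.
    exact: sum_within_le.
  by apply: sum_ord_le => [j|]; [exact: farle|rewrite !mulr_ge0].
apply: (@le_trans _ _ (\sum_(i < n) (6 * L%:R + n%:R * (4 * L%:R ^+ 2 * rho)))).
  by apply: ler_sum => i _; exact: bound.
rewrite sumr_const card_ord -[_ *+ _]mulr_natl.
have nL : 1 <= n%:R * L%:R :> R by rewrite -natrM ler1n muln_gt0 n_gt0.
have := rho_small; nra.
Qed.

Lemma kernel_fluctuation k :
  E (fun b => `|T k b - K k|) <= 6 * Num.sqrt n%:R * L%:R.
Proof.
set r := Num.sqrt n%:R.
have r0 : 0 < r by rewrite sqrtr_gt0 ltr0n.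
have r2 : r ^+ 2 = n%:R by rewrite sqr_sqrtr.
have L1 : 1 <= L%:R :> R by rewrite ler1n.
(* for this [t] both terms of the bound are at most of order [r * L] *)
have rL : 0 < r * L%:R by rewrite mulr_gt0// (lt_le_trans ltr01).
apply: (le_trans (Ex_norm_center lawmu (T k) rL)).
have : cov mu (T k) (T k) / (r * L%:R) <= 10 * r.
  rewrite ler_pdivrMr// (le_trans (var_kernel_le k))// -r2; nra.
nra.
Qed.

Section Lipschitz.
Variables (f : R -> R) (Lip : R).
Hypothesis lipf : forall x y, `|f x - f y| <= Lip * `|x - y|.

Lemma Lip_ge0 : 0 <= Lip.
Proof.
by have := le_trans (normr_ge0 _) (lipf 1 0); rewrite subr0 normr1 mulr1.
Qed.

Lemma step_norm k w : `|step f k w| <= Lip * h.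
Proof.
apply: (le_trans (lipf _ _)); rewrite ler_wpM2l ?Lip_ge0//.
rewrite (_ : _ - _ = h) ?gtr0_norm//.
by rewrite -natr1; ring.
Qed.

(** The bits far from [i] are nearly uncorrelated with bit [i]; a Lipschitz
function of their sum is dominated by a multiple of that sum. *)
Lemma punctured_cov (i : 'I_n) :
  `|E (fun b => (bit i b - E (bit i)) * f (W b - h * (M i b)%:R))|
  <= Lip * h * (n%:R * rho).
Proof.
rewrite cov_centerl.
pose V b := \sum_(j | ~~ within m i j) (Lip * h) * bit j b.
have Lh : 0 <= Lip * h by rewrite mulr_ge0 ?Lip_ge0// ltW.
have We b : W b - h * (M i b)%:R =
   h * (\sum_(j | ~~ within m i j) bit j b) - h * \sum_j E (bit j).
  rewrite /W sumrB (bigID (within m i))/= local_countE; ring.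
have dV : dominated (fun b => f (W b - h * (M i b)%:R)) V.
  have key (a b : Om) : (forall i, a i ==> b i) ->
      `|f (W b - h * (M i b)%:R) - f (W a - h * (M i a)%:R)| <= V b - V a.
    move=> ab; apply: (le_trans (lipf _ _)).
    rewrite !We /V -!mulr_sumr.
    set sb := \sum_(j | _) bit j b; set sa := \sum_(j | _) bit j a.
    rewrite -[leRHS]mulrBr -mulrA ler_wpM2l ?Lip_ge0//.
    rewrite (_ : _ - _ = h * (sb - sa)); last by ring.
    rewrite ger0_norm// mulr_ge0 ?(ltW h_gt0)// subr_ge0.
    by apply: ler_sum => j _; exact: nondec_bit.
  by split=> a b /key; rewrite ler_norml; lra.
rewrite (le_trans (cov_dominated assocmu (dominated_bit R i) dV))//.
rewrite cov_sumr; under eq_bigr do rewrite covC covZl covC.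
by rewrite -mulr_sumr ler_wpM2l// far_sum_le.
Qed.

(** Telescoping from [f W] down to [f (W - h * M i)] leaves the expectations with
the neighbours removed, negligible by [punctured_cov], and weighted steps, whose
weights may be replaced by their means by [kernel_fluctuation]. *)
Lemma stein_identity :
  `|E (fun b => W b * f (W b)) - \sum_(k < L) h * K k * E (fun b => step f k (W b))|
  <= Lip * (7 * h ^+ 2 * Num.sqrt n%:R * L%:R ^+ 2).
Proof.
set r := Num.sqrt n%:R.
have r1 : 1 <= r by rewrite -sqrtr1 ler_wsqrtr// ler1n.
have L1 : 1 <= L%:R :> R by rewrite ler1n.
have Lip0 := Lip_ge0.
(* [e1] gathers the expectations with the neighbours removed, and [e2] the
   fluctuations of the weights around their means *)
pose e1 := \sum_i E (fun b => (bit i b - E (bit i)) * f (W b - h * (M i b)%:R)).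
pose e2 := \sum_(k < L) E (fun b => (T k b - K k) * step f k (W b)).
have -> : E (fun b => W b * f (W b)) =
    h * e1 + (\sum_(k < L) h * K k * E (fun b => step f k (W b)) + h * e2).
  rewrite /e1 /e2 -!Ex_sum -!ExZ.
  have -> : \sum_(k < L) h * K k * E (fun b => step f k (W b)) =
    E (fun b => \sum_(k < L) h * K k * step f k (W b)).
    by rewrite Ex_sum; apply: eq_bigr => k _; rewrite ExZ.
  rewrite -!ExD; apply: eq_Ex => b.
  rewrite !mulr_sumr -big_split/=.
  under [X in _ + X]eq_bigr => k _.
    rewrite (_ : _ + _ = h * (T k b * step f k (W b))); last by ring.
    rewrite /T mulr_suml mulr_sumr; over.
  rewrite exchange_big/= -big_split/= {1}/W mulr_sumr mulr_suml.
  apply: eq_bigr => i _.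
  rewrite {1}(telescope_steps f h (W b) (local_count_le i b)) mulrDr -mulrA.
  congr (_ + _); rewrite mulr_sumr; apply: eq_bigr => k _.
  by rewrite /step; ring.
rewrite (_ : _ - _ = h * e1 + h * e2); last by ring.
have b1 : `|e1| <= Lip * h.
  apply: (le_trans (ler_norm_sum _ _ _)).
  apply: (@le_trans _ _ (\sum_(i < n) Lip * h * (n%:R * rho))).
    by apply: ler_sum => i _; exact: punctured_cov.
  rewrite sumr_const card_ord -[_ *+ _]mulr_natl.
  rewrite (_ : _ * _ = Lip * h * (n%:R ^+ 2 * rho)); last by ring.
  by rewrite ler_piMr ?n2rho// mulr_ge0// ltW.
have b2 : `|e2| <= L%:R * (Lip * h * (6 * r * L%:R)).
  apply: (le_trans (ler_norm_sum _ _ _)).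
  have c0 : 0 <= Lip * h * (6 * r * L%:R).
    by rewrite !mulr_ge0// ?ltW// (lt_le_trans ltr01).
  apply: sum_ord_le => // k _.
  apply: (le_trans (Ex_norm lawmu _)).
  apply: (@le_trans _ _ (E (fun b => Lip * h * `|T k b - K k|))).
    apply: Ex_le => // b; rewrite normrM mulrC.
    by rewrite ler_wpM2r// step_norm.
  by rewrite ExZ ler_wpM2l ?kernel_fluctuation// mulr_ge0// ltW.
apply: (le_trans (ler_normD _ _)); rewrite !normrM (gtr0_norm h_gt0).
apply: (@le_trans _ _ (h * (Lip * h) + h * (L%:R * (Lip * h * (6 * r * L%:R))))).
  by rewrite lerD// ler_wpM2l// ltW.
have e : h * (L%:R * (Lip * h * (6 * r * L%:R))) =
  (Lip * h ^+ 2) * (6 * r * L%:R ^+ 2) by ring.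
have e' : Lip * (7 * h ^+ 2 * r * L%:R ^+ 2) =
  (Lip * h ^+ 2) * (7 * r * L%:R ^+ 2) by ring.
rewrite e e' (_ : h * (Lip * h) = (Lip * h ^+ 2) * 1); last by ring.
rewrite -mulrDr ler_wpM2l ?mulr_ge0 ?(ltW h_gt0)//.
have : 1 <= r * L%:R ^+ 2 by nra.
lra.
Qed.

End Lipschitz.

Lemma stdsum_sqr : E (fun b => W b ^+ 2) = 1.
Proof.
rewrite -unit_variance.
rewrite (@eq_Ex _ _ _ _ (fun b => h ^+ 2 * \sum_i (bit i b - E (bit i)) *
   (\sum_j (bit j b - E (bit j))))).
  rewrite ExZ Ex_sum; congr (_ * _); apply: eq_bigr => i _.
  rewrite cov_centerl cov_sumr; apply: eq_bigr => j _.
  by rewrite covC covBcl// covC.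
by move=> b; rewrite -mulr_suml /W; ring.
Qed.

Lemma stdsum_norm : E (fun b => `|W b|) <= 1.
Proof.
apply: (@le_trans _ _ (E (fun b => 2^-1 * W b ^+ 2 + 2^-1))); last first.
  by rewrite ExD ExZ Ex_cst// stdsum_sqr; lra.
apply: Ex_le => // b; rewrite -(real_normK (num_real (W b))).
have := sqr_ge0 (`|W b| - 1); nra.
Qed.

Hypothesis h_small : h ^+ 2 <= 2^-1.

Definition stein_error : R := 7 * h ^+ 2 * Num.sqrt n%:R * L%:R ^+ 2.
Local Notation err := stein_error.

Definition near_prob (z : R) : R := E (fun b => (`|W b - z| <= h * L%:R)%R%:R).

(** The kernel being nonnegative, a clipped linear test function, whose
increments are nonnegative and equal to the full step near [z], bounds the
probability of a short interval directly. *)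
Lemma concentration z : near_prob z <= 2 * (2 * (h * L%:R) + err).
Proof.
set lam := 2 * (h * L%:R).
have hL0 : 0 <= h * L%:R by rewrite mulr_ge0 ?(ltW h_gt0).
have lam0 : 0 <= lam by rewrite mulr_ge0.
pose f w := (`|w - z + lam| - `|w - z - lam|) / 2.
have lipf x y : `|f x - f y| <= 1 * `|x - y|.
  have key c : `| `|x - z + c| - `|y - z + c| | <= `|x - y|.
    have := ler_dist_dist (x - z + c) (y - z + c).
    by rewrite (_ : x - z + c - (y - z + c) = x - y); last by ring.
  move: (key lam) (key (- lam)); rewrite mul1r /f !ler_norml; lra.
have fmid w : `|w - z| <= lam -> f w = w - z.
  rewrite /f ler_norml => /andP[w1 w2].
  rewrite ger0_norm; last lra.
  rewrite ler0_norm; last lra.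
  by field.
have fbound w : `|f w| <= lam.
  rewrite /f ler_norml.
  by case: (ger0P (w - z + lam)); case: (ger0P (w - z - lam)); lra.
have fmono x y : x <= y -> f x <= f y.
  rewrite /f => xy.
  by case: (ger0P (x - z + lam)); case: (ger0P (x - z - lam));
     case: (ger0P (y - z + lam)); case: (ger0P (y - z - lam)); lra.
have stepge (k : 'I_L) w :
    h * (`|w - z| <= h * L%:R)%R%:R <= step f k w.
  have hk : h * k%:R <= h * k.+1%:R by rewrite ler_pM2l// ler_nat.
  case: (boolP (`|w - z| <= h * L%:R)) => [wz|_]; last first.
    by rewrite mulr0 subr_ge0 fmono// lerB.
  have kL : h * k.+1%:R <= h * L%:R by rewrite ler_pM2l// ler_nat.
  have k0 : 0 <= h * k%:R by rewrite mulr_ge0 ?(ltW h_gt0).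
  move: wz; rewrite ler_norml => /andP[w1 w2].
  rewrite /step !fmid.
  - by rewrite mulr1 -natr1; lra.
  - by rewrite ler_norml /lam; lra.
  - by rewrite ler_norml /lam; lra.
have := stein_identity lipf; rewrite mul1r -/err ler_distl => /andP[low _].
have up : E (fun b => W b * f (W b)) <= lam.
  apply: (@le_trans _ _ (E (fun b => lam * `|W b|))).
    apply: Ex_le => // b; rewrite (le_trans (ler_norm _))// normrM mulrC.
    by rewrite ler_wpM2r.
  by rewrite ExZ ler_piMr// stdsum_norm.
have Q0 : 0 <= near_prob z by apply: Ex_ge0.
have mid : S * near_prob z <=
    \sum_(k < L) h * K k * E (fun b => step f k (W b)).
  rewrite /S [X in X * _]mulr_sumr mulr_suml; apply: ler_sum => k _.
  rewrite (_ : _ * _ = h * K k * (h * near_prob z)); last by ring.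
  rewrite ler_wpM2l ?mulr_ge0 ?(ltW h_gt0) ?kernel_mass_ge0//.
  by rewrite /near_prob -ExZ; apply: Ex_le => // b; exact: stepge.
have S2 : 2^-1 <= S by have := total_mass_ge; have := h_small; lra.
have := ler_wpM2r Q0 S2; lra.
Qed.

(** Away from [z] the steps of [f] follow Stein's equation up to a change of the
argument by [h * L]; near [z] they are only bounded, which [concentration] pays
for.  The function [f] is any function with the properties of the
solution of Stein's equation for the half-line up to [z], where [c] stands for
the normal probability of that half-line. *)
Lemma stein_approximation (z c C0 : R) (f : R -> R) :
  0 <= c <= 1 -> (forall x y, `|f x - f y| <= 2 * `|x - y|) ->
  (forall x, `|f x| <= C0) -> (forall x, `|x * f x| <= 1) ->
  (forall x y, x < y -> y < z \/ z < x -> exists2 t, x <= t <= y &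
     f y - f x = (y - x) * (t * f t + (y <= z)%R%:R - c)) ->
  `|E (fun b => (W b <= z)%R%:R) - c| <=
    2 * (h ^+ 2 + (18 + C0) * (h * L%:R) + 10 * err).
Proof.
move=> /andP[c0 c1] lipf fC xf steq.
have hL0 : 0 <= h * L%:R by rewrite mulr_ge0 ?(ltW h_gt0).
have C0_ge0 : 0 <= C0 by exact: le_trans (normr_ge0 _) (fC 0).
have err0 : 0 <= err.
  by rewrite /err !mulr_ge0 ?sqrtr_ge0 ?(ltW h_gt0).
pose J w : R := (w <= z)%R%:R.
have J01 w : 0 <= J w <= 1 by rewrite /J; case: (w <= z); rewrite ?lexx ?ler01.
pose I w : R := (`|w - z| <= h * L%:R)%R%:R.
have I0 w : 0 <= I w by rewrite /I; case: (`|_| <= _).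
pose g w := w * f w + J w - c.
have steperr (k : 'I_L) w : `|step f k w - h * g w| <=
    h * ((2 * `|w| + C0) * (h * L%:R) + 4 * I w).
  have hk : h * k.+1%:R = h * k%:R + h by rewrite -natr1; ring.
  have kL : h * k.+1%:R <= h * L%:R by rewrite ler_pM2l// ler_nat.
  have k0 : 0 <= h * k%:R by rewrite mulr_ge0 ?(ltW h_gt0).
  have pos : 0 <= (2 * `|w| + C0) * (h * L%:R) by rewrite mulr_ge0 ?addr_ge0// mulr_ge0.
  case: (boolP (`|w - z| <= h * L%:R)) => wz.
    have g2 : `|g w| <= 2.
      have := xf w; have /andP[] := J01 w; rewrite /g !ler_norml; lra.
    have hg2 : `|h * g w| <= h * 2 by rewrite normrM gtr0_norm// ler_pM2l.
    have hpos := mulr_ge0 (ltW h_gt0) pos; have stepk := step_norm lipf k w.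
    by rewrite /I wz mulr1 (le_trans (ler_normB _ _))//; lra.
  have {}wz : w < z \/ z < w - h * L%:R.
    by move: wz; rewrite -ltNge lter_normr => /orP[?|?]; [right|left]; lra.
  have [||t /andP[t1 t2] e] := steq (w - h * k.+1%:R) (w - h * k%:R).
  - have := h_gt0; lra.
  - by case: wz => wz; [left|right]; lra.
  rewrite /step e.
  have -> : ((w - h * k%:R <= z) : bool) = (w <= z).
    by case: wz => wz; apply/idP/idP; lra.
  rewrite (_ : _ - _ = h * ((t - w) * f t + w * (f t - f w))); last first.
    by rewrite /g /J hk; ring.
  rewrite normrM gtr0_norm// ler_pM2l// (le_trans (ler_normD _ _))// !normrM.
  have tw : `|t - w| <= h * L%:R by rewrite ler_norml; lra.
  have ftw : `|f t - f w| <= 2 * (h * L%:R).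
    by rewrite (le_trans (lipf _ _))// ler_pM2l.
  have := fC t; have := normr_ge0 (f t); have := normr_ge0 w.
  have := normr_ge0 (t - w); have := I0 w; have := normr_ge0 (f t - f w).
  nra.
set Q := 2 * (2 * (h * L%:R) + err).
have errk (k : 'I_L) : `|E (fun b => step f k (W b)) - h * E (fun b => g (W b))|
    <= h * ((2 + C0) * (h * L%:R) + 4 * Q).
  rewrite -ExZ -ExB (le_trans (Ex_norm lawmu _))//.
  apply: (@le_trans _ _ (E (fun b => h * (2 * (h * L%:R) * `|W b| +
      C0 * (h * L%:R) + 4 * I (W b))))).
    apply: Ex_le => // b; apply: (le_trans (steperr k (W b))).
    by rewrite le_eqVlt; apply/orP; left; apply/eqP; ring.
  rewrite ExZ ler_pM2l// 2!ExD Ex_cst// 2!ExZ.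
  rewrite -[E (fun b => I (W b))]/(near_prob z).
  have := ler_wpM2l hL0 stdsum_norm; have := concentration z; rewrite -/Q.
  lra.
set G := E (fun b => g (W b)) in errk.
have sumerr : `|\sum_(k < L) h * K k * E (fun b => step f k (W b)) - S * G| <=
    (2 + C0) * (h * L%:R) + 4 * Q.
  have -> : S * G = \sum_(k < L) h * K k * (h * G).
    rewrite /S [h ^+ 2 * \sum_(_ < _) _]mulr_sumr mulr_suml.
    by apply: eq_bigr => k _; ring.
  rewrite -sumrB (le_trans (ler_norm_sum _ _ _))//.
  apply: (@le_trans _ _ (\sum_(k < L) h * K k *
      (h * ((2 + C0) * (h * L%:R) + 4 * Q)))).
    apply: ler_sum => k _; rewrite -mulrBr normrM ger0_norm.
      by rewrite ler_wpM2l// mulr_ge0 ?(ltW h_gt0)// kernel_mass_ge0.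
    by rewrite mulr_ge0 ?(ltW h_gt0)// kernel_mass_ge0.
  rewrite (_ : \sum_(k < L) _ = S * ((2 + C0) * (h * L%:R) + 4 * Q)); last first.
    rewrite /S [h ^+ 2 * \sum_(_ < _) _]mulr_sumr mulr_suml.
    by apply: eq_bigr => k _; ring.
  rewrite ler_piMl ?total_mass_le1//.
  have := mulr_ge0 C0_ge0 hL0; rewrite /Q; lra.
have gE : G = E (fun b => W b * f (W b)) + E (fun b => J (W b)) - c.
  by rewrite /G /g ExB ExD Ex_cst.
have Wf1 : `|E (fun b => W b * f (W b))| <= 1.
  by apply: Ex_norm_le => // b; exact: xf.
have := stein_identity lipf; rewrite -/err.
have := total_mass_ge; have := total_mass_le1.
move: sumerr Wf1; rewrite gE /Q.
rewrite -[E (fun b => (W b <= z)%R%:R)]/(E (fun b => J (W b))).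
set Wf := E (fun b => W b * f (W b)); set PJ := E (fun b => J (W b)).
set Sg := \sum_(k < L) _.
rewrite !ler_norml => /andP[? ?] /andP[? ?] ? ? /andP[? ?].
set B := h ^+ 2 + (18 + C0) * (h * L%:R) + 10 * err.
have halve x : S * x <= B -> x <= 2 * B.
  case: (lerP 0 x) => x0 SxB.
    have S2 : 2^-1 <= S by have := h_small; lra.
    have := ler_wpM2r x0 S2; lra.
  have B0 : 0 <= B by have := sqr_ge0 h; have := mulr_ge0 C0_ge0 hL0; rewrite /B; lra.
  lra.
have SWf : `|(1 - S) * Wf| <= h ^+ 2.
  have Wf1 : `|Wf| <= 1 by rewrite ler_norml; apply/andP.
  rewrite normrM ger0_norm ?subr_ge0//.
  apply: (@le_trans _ _ (1 - S)); last by lra.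
  by rewrite ler_piMr// subr_ge0.
move: SWf; rewrite ler_norml => /andP[? ?].
by apply/andP; split; [rewrite lerNl|]; apply: halve; rewrite /B; lra.
Qed.

End SteinIdentity.

(** * The normal distribution function and the solution of Stein's equation *)

Section DistributionLimits.
Context d (T : measurableType d) (R : realType) (P : probability T R).
Variable Y : {RV P >-> R}.

Lemma distr_fun_cvg1 (e : R) : 0 < e -> exists M, 1 - distr_fun Y M <= e.
Proof.
move=> e0; have /fine_cvgP[_] := cvg_cdfy1 Y.
move=> /cvgrPdist_le/(_ e e0)[M [_ HM]]; exists (M + 1).
have := HM (M + 1) (ltr_pwDr ltr01 (lexx _)).
by move=> /(le_trans (ler_norm _)).
Qed.

Lemma distr_fun_cvg0 (e : R) : 0 < e -> exists M, distr_fun Y M <= e.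
Proof.
move=> e0; have /fine_cvgP[_] := cvg_cdfNy0 Y.
move=> /cvgrPdist_le/(_ e e0)[M [_ HM]]; exists (M - 1).
have : M - 1 < M by rewrite ltrBlDr ltrDl.
by move=> /HM /=; rewrite distrC subr0 => /(le_trans (ler_norm _)).
Qed.

End DistributionLimits.

Section Normal.
Variable R : realType.
Implicit Types x y z t w a : R.

Definition phi : R -> R := normal_pdf 0 1.
Definition ncdf t : R := fine (Phi t).

Lemma PhiE t : Phi t = (ncdf t)%:E.
Proof. by rewrite /ncdf fineK// /Phi fin_num_measure. Qed.

Lemma phiE x : phi x = normal_peak 1 * expR (- x ^+ 2 / 2).
Proof.
rewrite /phi normal_pdfE ?oner_neq0// /normal_fun subr0.
by rewrite expr1n.
Qed.

Lemma peak_le1 : normal_peak (1 : R) <= 1.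
Proof.
rewrite /normal_peak invf_le1; last first.
  by rewrite sqrtr_gt0 mulrn_wgt0// mulr_gt0 ?pi_gt0// exprn_gt0.
rewrite -[leLHS]sqrtr1 ler_wsqrtr// expr1n mul1r -mulr_natr.
suff: (1 <= pi * 2 :> R) by []; have p2 : (2 <= pi :> R) by exact: pi_ge2.
lra.
Qed.

Lemma phi_gt0 x : 0 < phi x.
Proof. by rewrite phiE mulr_gt0 ?expR_gt0// normal_peak_gt0 ?oner_neq0. Qed.

Lemma phi_leexp x : phi x <= expR (- x ^+ 2 / 2).
Proof. by rewrite phiE ler_piMl ?expR_ge0// peak_le1. Qed.

Lemma phi_le1 x : phi x <= 1.
Proof.
rewrite (le_trans (phi_leexp x))// -[leRHS]expR0 ler_expR.
by have := sqr_ge0 x; lra.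
Qed.

Lemma phiN x : phi (- x) = phi x.
Proof. by rewrite !phiE sqrrN. Qed.

Lemma is_derive_expsqr (c x : R) :
  is_derive x 1 (fun y : R => expR (c * y ^+ 2)) (2 * c * x * expR (c * x ^+ 2)).
Proof.
have d1 : is_derive x 1 (fun y : R => c * y ^+ 2) (2 * c * x).
  apply: is_derive_eq; rewrite /GRing.scale/=. ring.
have := @is_derive1_comp R expR (fun y : R => c * y ^+ 2) x _ _
  (is_derive_expR _) d1.
by rewrite mulrC.
Qed.

Lemma is_derive_phi x : is_derive x 1 phi (- x * phi x).
Proof.
have -> : phi = fun x => normal_peak 1 * expR (- 2^-1 * x ^+ 2).
  by apply/funext => y; rewrite phiE; congr (_ * expR _); field.
have d := is_derive_expsqr (- 2^-1) x.
apply: is_derive_eq; rewrite /GRing.scale/=.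
by field.
Qed.

Definition rphi x : R := (normal_peak 1)^-1 * expR (2^-1 * x ^+ 2).

Lemma rphiE x : rphi x = (phi x)^-1.
Proof.
rewrite /rphi phiE invfM -expRN; congr (_ * expR _); by field.
Qed.

Lemma is_derive_rphi x : is_derive x 1 rphi (x * rphi x).
Proof.
have d := is_derive_expsqr 2^-1 x.
apply: is_derive_eq; rewrite /GRing.scale/= /rphi.
by field; rewrite gt_eqF// normal_peak_gt0 ?oner_neq0.
Qed.

Lemma is_derive_ncdf x : is_derive x 1 ncdf (phi x).
Proof.
have [||||d e] := @continuous_FTC1 R phi -oo%O x (x + 1).
- by rewrite ltrDl.
- apply: integrableS (integrable_normal_pdf 0 1) => //.
- by rewrite ltNyr.
- by apply: continuous_normal_pdf; rewrite oner_neq0.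
by rewrite -e derive1E; exact: derivableP.
Qed.

Lemma mvt_everywhere (F dF : R -> R) x y :
  (forall z, is_derive z 1 F (dF z)) -> x < y ->
  exists2 c, x <= c <= y & F y - F x = dF c * (y - x).
Proof.
move=> dFP xy.
have cF : {within `[x, y], continuous F}.
  apply: continuous_subspaceT => z.
  by apply/differentiable_continuous/derivable1_diffP; case: (dFP z).
have [c cxy e] := @MVT R F dF x y xy (fun z _ => dFP z) cF.
by exists c => //; move: cxy; rewrite in_itv/= => /andP[/ltW -> /ltW ->].
Qed.

Lemma ncdf_ge0 x : 0 <= ncdf x.
Proof. by rewrite fine_ge0. Qed.

Lemma ncdf_le1 x : ncdf x <= 1.
Proof. by rewrite -lee_fin -PhiE; exact: probability_le1. Qed.

Lemma ncdf_lip x y : `|ncdf x - ncdf y| <= `|x - y|.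
Proof.
wlog xy : x y / x < y => [h|].
  case: (ltgtP x y) => [/h//|/h|->]; last by rewrite !subrr.
  by rewrite distrC [leRHS]distrC.
have [c _ e] := mvt_everywhere is_derive_ncdf xy.
rewrite distrC [leRHS]distrC e normrM ler_piMl// gtr0_norm ?phi_gt0//.
exact: phi_le1.
Qed.

Lemma ncdf_le x y : x <= y -> ncdf x <= ncdf y.
Proof.
rewrite le_eqVlt => /orP[/eqP->//|xy].
have [c _ e] := mvt_everywhere is_derive_ncdf xy.
by rewrite -subr_ge0 e mulr_ge0 ?subr_ge0 ?(ltW xy)// ltW// phi_gt0.
Qed.

Let idR : measurableTypeR R -> R := idfun.

#[local] HB.instance Definition _ :=
  @isMeasurableFun.Build _ _ _ _ idR (@measurable_id _ _ setT).

Lemma ncdf_cvg1 e : 0 < e -> exists M, 1 - ncdf M <= e.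
Proof. exact: (distr_fun_cvg1 (idR : {RV (normal_prob 0 1) >-> R})). Qed.

Lemma ncdf_cvg0 e : 0 < e -> exists M, ncdf M <= e.
Proof. exact: (distr_fun_cvg0 (idR : {RV (normal_prob 0 1) >-> R})). Qed.

(** Mills' inequality for any function that, like the upper tail, decreases to
zero with derivative [- phi]: for [x >= a] the function [phi x / a - U x] has
derivative [phi x * (1 - x / a) <= 0]. *)
Lemma mills (U : R -> R) a : (forall x, is_derive x 1 U (- phi x)) ->
  (forall e, 0 < e -> exists M, U M <= e) -> 0 < a -> a * U a <= phi a.
Proof.
move=> dU U0 a0; apply/ler_addgt0Pr => e e0.
have Ule x y : x <= y -> U y <= U x.
  rewrite le_eqVlt => /orP[/eqP->//|xy].
  have [c _ ec] := mvt_everywhere dU xy.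
  rewrite -subr_le0 ec mulNr oppr_le0 mulr_ge0 ?subr_ge0 ?(ltW xy)//.
  by rewrite ltW// phi_gt0.
have [M UM] := U0 (e / a) (divr_gt0 e0 a0).
pose b := Num.max M (a + 1).
have ab : a < b by rewrite lt_max (ltr_pwDr ltr01) ?orbT.
have Ub : a * U b <= e.
  rewrite mulrC -ler_pdivlMr// (le_trans _ UM)// Ule//.
  by rewrite le_max lexx.
pose g x := phi x + (- a) * U x.
have dg x : is_derive x 1 g ((a - x) * phi x).
  have d1 := is_derive_phi x; have d2 := dU x.
  by apply: is_derive_eq; rewrite /GRing.scale/=; ring.
have [c /andP[ac cb] ec] := mvt_everywhere dg ab.
have := phi_gt0 b; have := phi_gt0 c; move: ec; rewrite /g => ec pc pb.
have : (a - c) * phi c * (b - a) <= 0.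
  by rewrite pmulr_lle0 ?subr_gt0// pmulr_lle0// subr_le0.
lra.
Qed.

Definition tail_bound : R := (phi 1)^-1.

(** Mills' inequality from 1 on, and the trivial bound on [U] before. *)
Lemma tail_ratio (U : R -> R) a : (forall x, is_derive x 1 U (- phi x)) ->
  (forall e, 0 < e -> exists M, U M <= e) -> (forall x, U x <= 1) ->
  0 <= a -> U a <= tail_bound * phi a.
Proof.
move=> dU U0 U1 a0; rewrite /tail_bound mulrC.
have p1 := phi_gt0 1.
case: (lerP 1 a) => a1.
  have pa := phi_gt0 a.
  have aU := mills dU U0 (lt_le_trans ltr01 a1).
  have : 1 <= (phi 1)^-1 by rewrite invf_ge1// phi_le1.
  case: (lerP (U a) 0) => Ua.
    by move=> ?; rewrite (le_trans Ua)// mulr_ge0// ltW// invr_gt0.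
  nra.
rewrite (le_trans (U1 a))// ler_pdivlMr// mul1r !phiE.
rewrite ler_wpM2l ?normal_peak_ge0// ler_expR; nra.
Qed.

Definition uppertail x : R := 1 - ncdf x.
Definition lowertail x : R := ncdf (- x).

Lemma is_derive_uppertail x : is_derive x 1 uppertail (- phi x).
Proof.
have d := is_derive_ncdf x.
rewrite /uppertail; apply: is_derive_eq. by rewrite add0r mul1r.
Qed.

Lemma is_derive_lowertail x : is_derive x 1 lowertail (- phi x).
Proof.
have := @is_derive1_comp R ncdf -%R x _ _ (is_derive_ncdf _) (is_deriveNid _ _).
by rewrite phiN mulrN1.
Qed.

Lemma uppertail_cvg0 e : 0 < e -> exists M, uppertail M <= e.
Proof. exact: ncdf_cvg1. Qed.

Lemma lowertail_cvg0 e : 0 < e -> exists M, lowertail M <= e.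
Proof. by move=> /ncdf_cvg0[M ?]; exists (- M); rewrite /lowertail opprK. Qed.

Lemma uppertail_le1 x : uppertail x <= 1.
Proof. by rewrite /uppertail gerBl ncdf_ge0. Qed.

Lemma lowertail_le1 x : lowertail x <= 1.
Proof. exact: ncdf_le1. Qed.

(** The bounded solution of Stein's equation
[f' w = w * f w + (w <= z) - ncdf z].  The minimum and the maximum put its two
branches into one formula, from which both comparisons with the ratio of a
Gaussian tail to the density follow for every [w]. *)
Definition stein_sol z w : R :=
  ncdf (Num.min w z) * (1 - ncdf (Num.max w z)) * rphi w.

Lemma rphi_ge0 w : 0 <= rphi w.
Proof. by rewrite rphiE invr_ge0 ltW// phi_gt0. Qed.

Lemma stein_sol_ge0 z w : 0 <= stein_sol z w.
Proof.
apply: mulr_ge0 (rphi_ge0 _); apply: mulr_ge0 (ncdf_ge0 _) _.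
by rewrite subr_ge0 ncdf_le1.
Qed.

Lemma stein_sol_lower z w : stein_sol z w <= ncdf w * rphi w.
Proof.
rewrite ler_wpM2r ?rphi_ge0//.
apply: (@le_trans _ _ (ncdf w * 1)); last by rewrite mulr1.
rewrite ler_pM ?ncdf_ge0 ?subr_ge0 ?ncdf_le1//.
  by rewrite ncdf_le// ge_min lexx.
by rewrite gerBl ncdf_ge0.
Qed.

Lemma stein_sol_upper z w : stein_sol z w <= uppertail w * rphi w.
Proof.
rewrite ler_wpM2r ?rphi_ge0//.
apply: (@le_trans _ _ (1 * uppertail w)); last by rewrite mul1r.
rewrite ler_pM ?ncdf_ge0 ?subr_ge0 ?ncdf_le1//.
by rewrite lerB// ncdf_le// le_max lexx.
Qed.

Lemma stein_sol_bound z w : `|stein_sol z w| <= tail_bound.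
Proof.
rewrite ger0_norm ?stein_sol_ge0//; case: (lerP 0 w) => w0.
  rewrite (le_trans (stein_sol_upper z w))// rphiE ler_pdivrMr ?phi_gt0//.
  by apply: (tail_ratio is_derive_uppertail uppertail_cvg0 uppertail_le1).
rewrite (le_trans (stein_sol_lower z w))// rphiE ler_pdivrMr ?phi_gt0//.
have := tail_ratio is_derive_lowertail lowertail_cvg0 lowertail_le1 (a := - w).
by rewrite /lowertail opprK phiN; apply; rewrite oppr_ge0 ltW.
Qed.

Lemma stein_sol_mul_bound z w : `|w * stein_sol z w| <= 1.
Proof.
rewrite normrM [X in _ * X]ger0_norm ?stein_sol_ge0//; case: (ltgtP 0 w) => w0.
- rewrite gtr0_norm//.
  apply: (le_trans (ler_wpM2l (ltW w0) (stein_sol_upper z w))).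
  rewrite mulrA rphiE ler_pdivrMr ?phi_gt0// mul1r.
  exact: (mills is_derive_uppertail uppertail_cvg0).
- rewrite ltr0_norm//; have w0' : 0 < - w by rewrite oppr_gt0.
  apply: (le_trans (ler_wpM2l (ltW w0') (stein_sol_lower z w))).
  rewrite mulrA rphiE ler_pdivrMr ?phi_gt0// mul1r.
  have := mills is_derive_lowertail lowertail_cvg0 w0'.
  by rewrite /lowertail opprK phiN.
- by rewrite -w0 normr0 mul0r ler01.
Qed.

Lemma stein_sol_left z w : w <= z ->
  stein_sol z w = (1 - ncdf z) * (ncdf w * rphi w).
Proof. by move=> wz; rewrite /stein_sol (min_idPl wz) (max_idPr wz); ring. Qed.

Lemma stein_sol_right z w : z <= w ->
  stein_sol z w = ncdf z * (uppertail w * rphi w).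
Proof. by move=> wz; rewrite /stein_sol (min_idPr wz) (max_idPl wz) mulrA. Qed.

Lemma is_derive_stein_left z w :
  is_derive w 1 (fun w => (1 - ncdf z) * (ncdf w * rphi w))
    (w * ((1 - ncdf z) * (ncdf w * rphi w)) + 1 - ncdf z).
Proof.
have d1 := is_derive_ncdf w; have d2 := is_derive_rphi w.
apply: is_derive_eq; rewrite /GRing.scale/= rphiE.
by field; rewrite gt_eqF// phi_gt0.
Qed.

Lemma is_derive_stein_right z w :
  is_derive w 1 (fun w => ncdf z * (uppertail w * rphi w))
    (w * (ncdf z * (uppertail w * rphi w)) + 0 - ncdf z).
Proof.
have d1 := is_derive_uppertail w; have d2 := is_derive_rphi w.
apply: is_derive_eq; rewrite /GRing.scale/= rphiE.
by field; rewrite gt_eqF// phi_gt0.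
Qed.

Lemma stein_sol_eq_left z x y : x < y -> y <= z ->
  exists2 t, x <= t <= y & stein_sol z y - stein_sol z x =
    (y - x) * (t * stein_sol z t + 1 - ncdf z).
Proof.
move=> xy yz.
have [t /andP[xt ty] e] := mvt_everywhere (is_derive_stein_left z) xy.
exists t; first by rewrite xt.
rewrite !stein_sol_left ?e 1?mulrC//; first exact: le_trans yz.
exact: le_trans (ltW xy) yz.
Qed.

Lemma stein_sol_eq_right z x y : x < y -> z <= x ->
  exists2 t, x <= t <= y & stein_sol z y - stein_sol z x =
    (y - x) * (t * stein_sol z t + 0 - ncdf z).
Proof.
move=> xy zx.
have [t /andP[xt ty] e] := mvt_everywhere (is_derive_stein_right z) xy.
exists t; first by rewrite xt.
rewrite !stein_sol_right ?e 1?mulrC//; first exact: le_trans xt.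
exact: le_trans zx (ltW xy).
Qed.

(** Stein's equation bounds the slope of each branch by 2, and the branches meet
at [z]. *)
Lemma stein_sol_lip z x y : `|stein_sol z x - stein_sol z y| <= 2 * `|x - y|.
Proof.
wlog xy : x y / x < y => [h|].
  case: (ltgtP x y) => [/h//|/h|->]; last by rewrite !subrr normr0 mulr0.
  by rewrite distrC [in leRHS]distrC.
have slope a b (c : R) t : 0 <= c <= 1 -> a < b ->
    `|(b - a) * (t * stein_sol z t + c - ncdf z)| <= 2 * (b - a).
  move=> /andP[c0 c1] ab; rewrite normrM gtr0_norm ?subr_gt0// mulrC.
  rewrite ler_wpM2r ?subr_ge0 ?(ltW ab)//.
  have := stein_sol_mul_bound z t; have := ncdf_ge0 z; have := ncdf_le1 z.
  rewrite !ler_norml; lra.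
have left a b : a < b -> b <= z ->
    `|stein_sol z b - stein_sol z a| <= 2 * (b - a).
  move=> ab bz; have [t _ ->] := stein_sol_eq_left ab bz.
  by apply: slope; rewrite ?ler01 ?lexx.
have right a b : a < b -> z <= a ->
    `|stein_sol z b - stein_sol z a| <= 2 * (b - a).
  move=> ab za; have [t _ ->] := stein_sol_eq_right ab za.
  by apply: slope; rewrite ?ler01 ?lexx.
rewrite distrC [in leRHS]distrC [`|y - x|]gtr0_norm ?subr_gt0//.
case: (lerP y z) => yz; first exact: left.
case: (lerP z x) => zx; first exact: right.
rewrite (_ : _ - _ = (stein_sol z y - stein_sol z z) +
                     (stein_sol z z - stein_sol z x)); last by ring.
rewrite (le_trans (ler_normD _ _))//.
have := left _ _ zx (lexx z); have := right _ _ yz (lexx z); lra.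
Qed.

Lemma stein_sol_eq z x y : x < y -> y < z \/ z < x ->
  exists2 t, x <= t <= y & stein_sol z y - stein_sol z x =
    (y - x) * (t * stein_sol z t + (y <= z)%R%:R - ncdf z).
Proof.
move=> xy [yz|zx].
  by rewrite (ltW yz); exact: stein_sol_eq_left (ltW yz).
by rewrite leNgt (lt_trans zx xy); exact: stein_sol_eq_right (ltW zx).
Qed.

End Normal.

(** * Real-valued expectations and covariances *)

Section RealExpectation.
Context d (T : measurableType d) (R : realType) (P : probability T R).
Implicit Types f g : T -> R.

Definition rE f : R := fine ('E_P[f])%E.
Definition rcov f g : R := rE (f \* g) - rE f * rE g.

Lemma rE_EFin f : f \in Lfun P 1 -> ('E_P[f] = (rE f)%:E)%E.
Proof. by move=> fL; rewrite /rE fineK// expectation_fin_num. Qed.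

Lemma bounded_Lfun2 f (c : R) : measurable_fun setT f ->
  (forall w, `|f w| <= c) -> f \in Lfun P 2%:E.
Proof.
move=> mf fc; rewrite inE/=; apply/andP; split; rewrite inE//=.
rewrite /finite_norm unlock poweR_lty//.
have c0 : 0 <= c by exact: le_trans (normr_ge0 _) (fc point).
apply: (@le_lt_trans _ _ (\int[P]_x (cst (c `^ 2)%:E x))%E).
  apply: ge0_le_integral => //.
  - by move=> w _; rewrite lee_fin powR_ge0.
  - apply/measurable_EFinP.
    apply: (measurableT_comp (measurable_powR _)).
    exact: measurableT_comp.
  - by move=> w _ /=; rewrite lee_fin ge0_ler_powR// nnegrE.
by rewrite integral_cst//= probability_setT mule1 ltry.
Qed.

Lemma Lfun21 f : f \in Lfun P 2%:E -> f \in Lfun P 1.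
Proof. exact: (Lfun_subset12 (fin_num_measure P _ measurableT)). Qed.

Lemma Lfun2D f g : f \in Lfun P 2%:E -> g \in Lfun P 2%:E ->
  (f \+ g) \in Lfun P 2%:E.
Proof. by move=> fL gL; rewrite rpredD ?lee1n. Qed.

Lemma Lfun2Z (c : R) f : f \in Lfun P 2%:E -> (fun w => c * f w) \in Lfun P 2%:E.
Proof.
move=> fL; rewrite (_ : (fun w => _) = c \o* f); last first.
  by apply/funext => w /=; rewrite mulrC.
by apply: Lfun_scale => //; rewrite ler1n.
Qed.

Lemma rED f g : f \in Lfun P 1 -> g \in Lfun P 1 ->
  rE (fun w => f w + g w) = rE f + rE g.
Proof.
move=> fL gL; rewrite {1}/rE (expectationD fL gL) fineD ?expectation_fin_num//.
Qed.

Lemma rEZ (c : R) f : f \in Lfun P 1 -> rE (fun w => c * f w) = c * rE f.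
Proof.
move=> fL; rewrite {1}/rE (_ : (fun w => _) = c \o* f); last first.
  by apply/funext => w /=; rewrite mulrC.
by rewrite (expectationZl _ fL) fineM ?expectation_fin_num.
Qed.

Lemma rE_ge0 f : (forall w, 0 <= f w) -> 0 <= rE f.
Proof. by move=> f0; rewrite fine_ge0// expectation_ge0. Qed.

Lemma rE_le f g : f \in Lfun P 1 -> g \in Lfun P 1 ->
  (forall w, f w <= g w) -> rE f <= rE g.
Proof.
move=> fL gL fg.
have : 0 <= rE (fun w => g w + (-1) * f w).
  by apply: rE_ge0 => w; rewrite mulN1r subr_ge0.
have NfL : (fun w => -1 * f w) \in Lfun P 1.
  rewrite (_ : (fun w => _) = (-1) \o* f); last first.
    by apply/funext => w /=; rewrite mulrC.
  exact: Lfun_scale.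
by rewrite rED// rEZ// mulN1r subr_ge0.
Qed.

Lemma rE_indic (A : set T) : measurable A -> rE \1_A = fine (P A).
Proof. by move=> mA; rewrite /rE expectation_indic. Qed.

Lemma rcovE f g : f \in Lfun P 2%:E -> g \in Lfun P 2%:E ->
  covariance P f g = (rcov f g)%:E.
Proof.
move=> fL gL; have fgL := Lfun2_mul_Lfun1 fL gL.
rewrite covarianceE//; [|exact: Lfun21|exact: Lfun21].
rewrite (rE_EFin (Lfun21 fL)) (rE_EFin (Lfun21 gL)).
by rewrite (rE_EFin fgL).
Qed.

Lemma rcovC f g : rcov f g = rcov g f.
Proof.
rewrite /rcov [rE f * _]mulrC; congr (rE _ - _).
by apply/funext => w; rewrite /= mulrC.
Qed.

Lemma rcovBl f g h : f \in Lfun P 2%:E -> g \in Lfun P 2%:E ->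
  h \in Lfun P 2%:E -> forall c : R,
  rcov (fun w => c * f w - g w) h = c * rcov f h - rcov g h.
Proof.
move=> fL gL hL c; rewrite /rcov.
rewrite (_ : (fun w => c * f w - g w) = (fun w => c * f w + -1 * g w)); last first.
  by apply/funext => w; rewrite mulN1r.
rewrite (_ : _ \* h = fun w => c * (f w * h w) + -1 * (g w * h w)); last first.
  by apply/funext => w /=; ring.
have L1Z k u : u \in Lfun P 1 -> (fun w => k * u w) \in Lfun P 1.
  move=> uL; rewrite (_ : (fun w => _) = k \o* u); last first.
    by apply/funext => w /=; rewrite mulrC.
  exact: Lfun_scale.
rewrite rED ?rED ?rEZ ?L1Z//; do ?[exact: Lfun21|exact: Lfun2_mul_Lfun1].
by rewrite /GRing.mul_fun; ring.
Qed.

End RealExpectation.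

(** * The joint law of the exceedance bits *)

Section ExceedanceLaw.
Context d (T : measurableType d) (R : realType) (P : probability T R).
Variable X : nat -> {RV P >-> R}.
Implicit Types x : R.

Definition exceed n x (w : T) : {ffun 'I_n -> bool} := [ffun i => x < X (val i) w].
Definition exceed_law n x (b : {ffun 'I_n -> bool}) : R :=
  fine (P [set w | exceed n x w = b]).
Arguments exceed_law : clear implicits.

Lemma measurable_gt i x : measurable [set w | x < X i w].
Proof.
rewrite (_ : [set w | _] = X i @^-1` `]x, +oo[%classic).
  by rewrite -[X in measurable X]setTI; apply: measurable_funP.
by apply/seteqP; split => w /=; rewrite in_itv/= andbT.
Qed.

Lemma measurable_le i x : measurable [set w | X i w <= x].
Proof.
rewrite (_ : [set w | _] = ~` [set w | x < X i w]).
  by apply: measurableC; exact: measurable_gt.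
by apply/seteqP; split => w /=; rewrite leNgt => /negP.
Qed.

Lemma measurable_exceed n x b : measurable [set w | exceed n x w = b].
Proof.
rewrite (_ : [set w | _] =
    \bigcap_(i in [set: 'I_n]) [set w | (x < X (val i) w) = b i]).
  apply: fin_bigcap_measurable; first exact: finite_finset.
  move=> i _; case: (b i); first exact: measurable_gt.
  rewrite (_ : [set w | _] = [set w | X (val i) w <= x]).
    exact: measurable_le.
  by apply/seteqP; split => w /=; rewrite leNgt; [move=> ->|move/negbTE].
apply/seteqP; split => w /=.
  by move=> <- i _ /=; rewrite ffunE.
by move=> wb; apply/ffunP => i; rewrite ffunE; exact: wb.
Qed.

Lemma exceed_decomp n x (G : {ffun 'I_n -> bool} -> R) :
  (fun w => G (exceed n x w)) =
  (fun w => \sum_b G b * \1_[set w | exceed n x w = b] w).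
Proof.
apply/funext => w; rewrite (bigD1 (exceed n x w))//= big1 => [|b nb].
  by rewrite addr0 indicE mem_set ?mulr1.
rewrite indicE memNset ?mulr0// => /= e.
by rewrite e eqxx in nb.
Qed.

Lemma exceed_Lfun2 n x (G : {ffun 'I_n -> bool} -> R) :
  (fun w => G (exceed n x w)) \in Lfun P 2%:E.
Proof.
apply: (@bounded_Lfun2 _ _ _ _ _ (\sum_b `|G b|)).
  rewrite exceed_decomp; apply: measurable_sum => b.
  apply: measurable_funM => //; apply: measurable_indic.
  exact: measurable_exceed.
by move=> w; rewrite (bigD1 (exceed n x w))//= lerDl sumr_ge0.
Qed.

Lemma rE_exceed n x (G : {ffun 'I_n -> bool} -> R) :
  rE P (fun w => G (exceed n x w)) = Ex (exceed_law n x) G.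
Proof.
rewrite exceed_decomp /Ex.
have ind1 b : (\1_[set w | exceed n x w = b] : T -> R) \in Lfun P 1.
  apply: Lfun21; apply: (@bounded_Lfun2 _ _ _ _ _ 1).
    by apply: measurable_indic; exact: measurable_exceed.
  by move=> w; rewrite indicE; case: (_ \in _); rewrite ?normr1 ?normr0.
have term1 b : (fun w => G b * \1_[set w | exceed n x w = b] w) \in Lfun P 1.
  rewrite (_ : (fun w => _) = G b \o* \1_[set w | exceed n x w = b]).
    exact: Lfun_scale.
  by apply/funext => w /=; rewrite mulrC.
have [_] : (fun w => \sum_b G b * \1_[set w | exceed n x w = b] w) \in Lfun P 1
  /\ rE P (fun w => \sum_b G b * \1_[set w | exceed n x w = b] w) =
     \sum_b exceed_law n x b * G b; last by [].
elim: (index_enum _) => [|b s [IHL IH]].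
  rewrite (_ : (fun w => _) = cst 0); last by apply/funext => w; rewrite big_nil.
  by rewrite Lfun_cst big_nil /rE expectation_cst.
rewrite (_ : (fun w => _) = (fun w => G b * \1_[set w | exceed n x w = b] w +
   \sum_(b <- s) G b * \1_[set w | exceed n x w = b] w)); last first.
  by apply/funext => w; rewrite big_cons.
split; first exact: rpredD.
rewrite big_cons rED// IH rEZ// rE_indic; last exact: measurable_exceed.
by rewrite mulrC.
Qed.

Lemma rcov_exceed n x (G H : {ffun 'I_n -> bool} -> R) :
  rcov P (fun w => G (exceed n x w)) (fun w => H (exceed n x w)) =
  cov (exceed_law n x) G H.
Proof. by rewrite /rcov /cov -!rE_exceed. Qed.

Lemma exceed_law_is_law n x : is_law (exceed_law n x).
Proof.
split; first by move=> b; rewrite fine_ge0.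
have := rE_exceed x (fun _ : {ffun 'I_n -> bool} => 1).
rewrite /rE -[(fun _ : T => 1)]/(cst 1) expectation_cst /Ex /= => ->.
by apply: eq_bigr => b _; rewrite mulr1.
Qed.

Lemma exceed_event n x (Q : pred {ffun 'I_n -> bool}) :
  fine (P [set w | Q (exceed n x w)]) =
  Ex (exceed_law n x) (fun b => (Q b)%:R).
Proof.
rewrite -rE_exceed -rE_indic.
  congr (rE P _); apply/funext => w; rewrite indicE; congr (_%:R).
  by congr nat_of_bool; apply/idP/idP; rewrite inE.
rewrite (_ : [set w | _] = \bigcup_(b in [set b | Q b])
   [set w | exceed n x w = b]).
  apply: fin_bigcup_measurable; first exact: finite_finset.
  by move=> b _; exact: measurable_exceed.
apply/seteqP; split => w /=; first by move=> Qw; exists (exceed n x w).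
by case=> b /= Qb ->.
Qed.

(** A nondecreasing function of the bits is a nondecreasing function of the
observations. *)
Lemma exceed_law_assoc n x : associated X -> assoc (exceed_law n x).
Proof.
move=> aX G H nG nH.
pose lift (G : {ffun 'I_n -> bool} -> R) (u : n.-tuple R) : R :=
  G [ffun i => x < tnth u i].
have nlift K : nondec K -> coord_nondecreasing (lift K).
  move=> nK u v uv; apply: nK => i; rewrite !ffunE.
  by apply/implyP => /lt_le_trans; apply.
have liftE K : (fun w => lift K [tuple X (val j) w | j < n]) =
    (fun w => K (exceed n x w)).
  apply/funext => w; rewrite /lift; congr K; apply/ffunP => i.
  by rewrite !ffunE tnth_mktuple.
have /= := aX n val (lift G) (lift H) val_inj (nlift _ nG) (nlift _ nH).
rewrite !liftE rcovE ?exceed_Lfun2// lee_fin rcov_exceed; apply.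
split; do ?[by apply: Lfun21; exact: exceed_Lfun2].
by apply: Lfun2_mul_Lfun1; exact: exceed_Lfun2.
Qed.

Lemma ind_le_exceed n x (i : 'I_n) :
  ind_le (X i) x = (fun w => 1 - bit R i (exceed n x w)).
Proof.
apply/funext => w; rewrite /ind_le /bit ffunE indicE /=.
case: (ltP x (X i w)) => h; last by rewrite mem_set// subr0.
by rewrite memNset ?subrr//= leNgt h.
Qed.

Lemma ind_le_Lfun2 i x : ind_le (X i) x \in Lfun P 2%:E.
Proof.
rewrite (@ind_le_exceed i.+1 x ord_max).
exact: (exceed_Lfun2 x (fun b => 1 - bit R ord_max b)).
Qed.

Definition ind_cov k x : R := rcov P (ind_le (X 0%N) x) (ind_le (X k) x).

Lemma cov_bitE n x (i j : 'I_n) :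
  cov (exceed_law n x) (bit R i) (bit R j) =
  rcov P (ind_le (X i) x) (ind_le (X j) x).
Proof.
rewrite !ind_le_exceed; apply/esym.
rewrite (rcov_exceed x (fun b => 1 - bit R i b) (fun b => 1 - bit R j b)).
have lw := exceed_law_is_law n x.
have e (k : 'I_n) : (fun b => 1 - bit R k b) =1 (fun b => -1 * bit R k b - (- 1)).
  by move=> b; rewrite mulN1r opprK addrC.
rewrite (eq_cov _ (e i) (e j)) (covBcl lw (fun b => -1 * bit R i b)) covZl covC.
rewrite (covBcl lw (fun b => -1 * bit R j b)) covZl covC.
by rewrite mulN1r mulN1r opprK.
Qed.

Hypothesis statX : strictly_stationary X.

Lemma stationary1 k x : fine (P [set w | X k w <= x]) =
  fine (P [set w | X 0%N w <= x]).
Proof.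
pose B : set (1.-tuple R) := [set u | tnth u ord0 <= x].
have mB : measurable B.
  rewrite (_ : B = (fun u : 1.-tuple R => tnth u ord0) @^-1` `]-oo, x]%classic).
    by rewrite -[X in measurable X]setTI; exact: measurable_tnth.
  by apply/seteqP; split => w /=; rewrite in_itv.
have := statX (fun _ => 0%N) k mB; rewrite /B /preimage/= => e.
congr fine; rewrite -(_ : [set w | tnth [tuple X (0 + k)%N w | _ < 1] ord0 <= x]
  = [set w | X k w <= x]) ?e; last first.
  by apply/seteqP; split => w /=; rewrite tnth_mktuple add0n.
congr (P _); by apply/seteqP; split => w /=; rewrite tnth_mktuple.
Qed.

Lemma stationary2 i k x : fine (P [set w | X i w <= x /\ X (k + i)%N w <= x]) =
  fine (P [set w | X 0%N w <= x /\ X k w <= x]).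
Proof.
(* the indices 0 and [k], written [k * j], are shifted by [i] *)
pose B : set (2.-tuple R) := [set u | tnth u ord0 <= x /\ tnth u ord_max <= x].
have mB : measurable B.
  rewrite (_ : B = (fun u : 2.-tuple R => tnth u ord0) @^-1` `]-oo, x]%classic `&`
     (fun u : 2.-tuple R => tnth u ord_max) @^-1` `]-oo, x]%classic).
    by apply: measurableI; rewrite -[X in measurable X]setTI;
      exact: measurable_tnth.
  by apply/seteqP; split => w /=; rewrite !in_itv.
have := statX (fun j : 'I_2 => (k * j)%N) i mB; rewrite /B /preimage/= => e.
congr fine; rewrite -(_ : [set w |
  tnth [tuple X (k * j + i)%N w | j < 2] ord0 <= x /\
  tnth [tuple X (k * j + i)%N w | j < 2] ord_max <= x]
  = [set w | X i w <= x /\ X (k + i)%N w <= x]) ?e; last first.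
  by apply/seteqP; split => w /=; rewrite !tnth_mktuple/= muln0 muln1 add0n.
congr (P _); apply/seteqP.
by split => w /=; rewrite !tnth_mktuple/= muln0 muln1.
Qed.

Lemma rcov_ind_le i j x : rcov P (ind_le (X i) x) (ind_le (X j) x) =
  fine (P [set w | X i w <= x /\ X j w <= x]) -
  fine (P [set w | X i w <= x]) * fine (P [set w | X j w <= x]).
Proof.
rewrite /rcov /ind_le !rE_indic//; do ?[exact: measurable_le].
congr (_ - _); rewrite -rE_indic.
  congr (rE P _); apply/funext => w.
  rewrite (_ : [set w | _ /\ _] = [set w | X i w <= x] `&` [set w | X j w <= x])//.
  by rewrite indicI.
by apply: measurableI; exact: measurable_le.
Qed.

Lemma cov_bit_shift n x (i j : 'I_n) : (i <= j)%N ->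
  cov (exceed_law n x) (bit R i) (bit R j) = ind_cov (j - i) x.
Proof.
move=> ij; rewrite cov_bitE /ind_cov !rcov_ind_le -(subnK ij) addnK.
by rewrite stationary2 (stationary1 (_ + i)) (stationary1 i) (stationary1 (j - i)).
Qed.

End ExceedanceLaw.
Arguments exceed_law {d T R P} X n x b.

(** * Covariances of indicators and the distribution function *)

Section IndicatorCovariances.
Context d (T : measurableType d) (R : realType) (P : probability T R).
Variable X : nat -> {RV P >-> R}.
Hypothesis statX : strictly_stationary X.
Hypothesis assocX : associated X.
Hypothesis X2 : forall i, (X i : T -> R) \in Lfun P 2%:E.
Variables (f : R -> R) (M : R).
Hypothesis densf : is_density (X 0%N) f.
Hypothesis f_le : forall x, f x <= M.
Implicit Types x y : R.

Local Notation F := (distr_fun (X 0%N)).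

Lemma distr_funE x : F x = fine (P [set w | X 0%N w <= x]).
Proof.
rewrite /distr_fun /cdf /distribution /pushforward; congr (fine (P _)).
Qed.

Lemma distr_fun_rE i x : F x = rE P (ind_le (X i) x).
Proof.
by rewrite /ind_le rE_indic; [rewrite distr_funE stationary1|exact: measurable_le].
Qed.

Lemma distr_fun_mono x y : x <= y -> F x <= F y.
Proof.
move=> xy; rewrite /distr_fun fine_le ?fin_num_measure//.
exact: cdf_nondecreasing.
Qed.

Lemma density_bound_ge0 : 0 <= M.
Proof. by have [_ f0 _] := densf; exact: le_trans (f0 0) (f_le 0). Qed.

Lemma distr_fun_lip x y : x <= y -> F y - F x <= M * (y - x).
Proof.
move=> xy; have [mf f0 fd] := densf.
have xyF : distribution P (X 0%N) `]x, y]%classic = ((F y)%:E - (F x)%:E)%E.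
  have -> : `]x, y]%classic = `]-oo, y]%classic `\` `]-oo, x]%classic.
    apply/seteqP; split => z /=; rewrite !in_itv/= ltNge.
      by move=> /andP[/negP].
    by move=> [-> /negP ->].
  rewrite measureD//=; last by rewrite ltey_eq fin_num_measure.
  rewrite (_ : _ `&` _ = `]-oo, x]%classic); last first.
    by rewrite setIidr//; apply: subset_itvl; rewrite bnd_simp.
  by rewrite EFinN /distr_fun /cdf !fineK ?fin_num_measure.
rewrite -lee_fin EFinB -xyF fd//.
apply: (@le_trans _ _ (\int[lebesgue_measure]_(z in `]x, y]) (cst M%:E z))%E).
  apply: ge0_le_integral => //=.
  - by move=> z _; rewrite lee_fin.
  - by apply/measurable_EFinP; exact: measurable_funTS.
  - by move=> z _; rewrite lee_fin.
rewrite integral_cst//= lebesgue_measure_itv/= lte_fin.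
case: ltP => [_|_]; first by rewrite EFinM EFinB.
by rewrite mule0 lee_fin mulr_ge0 ?density_bound_ge0// subr_ge0.
Qed.

Lemma distr_fun_ge0 x : 0 <= F x.
Proof. by rewrite /distr_fun fine_ge0. Qed.

Lemma distr_fun_le1 x : F x <= 1.
Proof.
rewrite /distr_fun -[leRHS]/(fine 1%:E) fine_le ?fin_num_measure//.
exact: probability_le1.
Qed.

Lemma ind_leE i x w : ind_le (X i) x w = (X i w <= x)%R%:R.
Proof.
rewrite /ind_le indicE; case: (boolP (X i w <= x)) => h.
  by rewrite mem_set.
by rewrite memNset//= => hle; rewrite hle in h.
Qed.

Lemma assoc_pair (g h : R -> R) k : (0 < k)%N ->
  {homo g : x y / x <= y} -> {homo h : x y / x <= y} ->
  (fun w => g (X 0%N w)) \in Lfun P 2%:E ->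
  (fun w => h (X k w)) \in Lfun P 2%:E ->
  0 <= rcov P (fun w => g (X 0%N w)) (fun w => h (X k w)).
Proof.
move=> k0 ng nh gL hL.
(* the indices 0 and [k], as multiples of [k], are distinct since [0 < k] *)
pose idx (j : 'I_2) : nat := (k * j)%N.
have inj : injective idx.
  by move=> i j /eqP; rewrite eqn_pmul2l// => /eqP e; exact: val_inj.
have /= := assocX (i := idx) (g := fun u => g (tnth u ord0))
  (h := fun u => h (tnth u ord_max)) inj.
rewrite (_ : (fun w => g _) = (fun w => g (X 0%N w))); last first.
  by apply/funext => w; rewrite tnth_mktuple /idx muln0.
rewrite (_ : (fun w => h (tnth [tuple X (idx j) w | j < 2] ord_max)) =
  (fun w => h (X k w))); last first.
  by apply/funext => w; rewrite tnth_mktuple /idx muln1.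
rewrite rcovE// lee_fin; apply.
- by move=> u v uv; exact: ng.
- by move=> u v uv; exact: nh.
- by split; [exact: Lfun21|exact: Lfun21|exact: Lfun2_mul_Lfun1].
Qed.

Lemma ind_covE k x : ind_cov X k x =
  fine (P [set w | X 0%N w <= x /\ X k w <= x]) - F x * F x.
Proof. by rewrite /ind_cov rcov_ind_le (stationary1 statX k) distr_funE. Qed.

Lemma ind_cov0 x : ind_cov X 0 x = F x * (1 - F x).
Proof.
rewrite ind_covE (_ : [set w | _] = [set w | X 0%N w <= x]).
  by rewrite -distr_funE; ring.
by apply/seteqP; split => w /=; [case|].
Qed.

Lemma ind_cov_ge0 k x : 0 <= ind_cov X k x.
Proof.
have := @cov_bit_shift _ _ _ _ X statX k.+1 x ord0 ord_max (leq0n _).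
rewrite subn0 /= => <-.
by apply: cov_bit_ge0; exact: exceed_law_assoc.
Qed.

(** The two terms of the covariance, a joint probability and a product, both
grow by at most twice the increment of [F]. *)
Lemma ind_cov_lip k x y : x <= y ->
  `|ind_cov X k x - ind_cov X k y| <= 2 * (F y - F x).
Proof.
move=> xy.
have mJ z : measurable [set w | X 0%N w <= z /\ X k w <= z].
  rewrite (_ : [set w | _] = [set w | X 0%N w <= z] `&` [set w | X k w <= z])//.
  by apply: measurableI; exact: measurable_le.
pose J z : T -> R := \1_[set w | X 0%N w <= z /\ X k w <= z].
have JL z : J z \in Lfun P 1.
  apply: Lfun21; apply: (@bounded_Lfun2 _ _ _ _ _ 1).
    exact: measurable_indic.
  by move=> w; rewrite /J indicE; case: (_ \in _); rewrite ?normr1 ?normr0.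
have JE z w : J z w = ((X 0%N w <= z) && (X k w <= z))%R%:R.
  rewrite /J indicE; case: (boolP (_ && _)) => [/andP[? ?]|h].
    by rewrite mem_set.
  by rewrite memNset//= => -[a b]; rewrite a b in h.
have IL i z : ind_le (X i) z \in Lfun P 1 by exact/Lfun21/ind_le_Lfun2.
have J1 : rE P (J x) <= rE P (J y).
  apply: rE_le => // w; rewrite /J !indicE ler_nat.
  case: (boolP (w \in _)) => // /set_mem[/= a b].
  by rewrite mem_set//=; split; exact: le_trans xy.
have J2 : rE P (J y) <= rE P (J x) + 2 * (F y - F x).
  have D g h : g \in Lfun P 1 -> h \in Lfun P 1 ->
    (fun w => g w + h w) \in Lfun P 1 by move=> ? ?; exact: rpredD.
  have Lx := D _ _ (IL 0%N x) (IL k x); have Ly := D _ _ (IL 0%N y) (IL k y).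
  have : rE P (fun w => J y w + (ind_le (X 0%N) x w + ind_le (X k) x w)) <=
      rE P (fun w => J x w + (ind_le (X 0%N) y w + ind_le (X k) y w)).
    apply: rE_le; [exact: D|exact: D|].
    move=> w; rewrite !JE !ind_leE.
    have xyT i : X i w <= x -> X i w <= y by move=> /le_trans; apply.
    move: (xyT 0%N) (xyT k).
    case: (X 0%N w <= x); case: (X 0%N w <= y);
    case: (X k w <= x); case: (X k w <= y) => //= h0 hk;
    by [have := h0 isT|have := hk isT|lra].
  rewrite (rED (JL y) Lx) (rED (JL x) Ly) (rED (IL 0%N x) (IL k x)).
  rewrite (rED (IL 0%N y) (IL k y)) -!distr_fun_rE; lra.
rewrite !ind_covE -!rE_indic// -/(J x) -/(J y).
have := distr_fun_mono xy; have := distr_fun_ge0 x; have := distr_fun_le1 y.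
rewrite ler_norml => ? ? ?; apply/andP; split; nra.
Qed.

Definition clip (u : R) : R := Num.max (-1) (Num.min 0 u).

Lemma clip_cases u : [/\ -1 <= clip u, clip u <= 0, 0 <= u -> clip u = 0,
  u <= -1 -> clip u = -1 & -1 <= u -> u <= 0 -> clip u = u].
Proof.
rewrite /clip maxElt minElt.
case: (ltP 0 u) => u0; case: ifP => h; split=> //; lra.
Qed.

Lemma clip_mono u v : u <= v -> 0 <= clip v - clip u <= v - u.
Proof.
rewrite /clip !maxElt !minElt => uv.
case: (ltP 0 u) => u0; case: (ltP 0 v) => v0;
  do ?[case: ifP => ?]; lra.
Qed.

Lemma clip_Lfun2 i (c e : R) : (fun w => clip ((X i w - c) / e)) \in Lfun P 2%:E.
Proof.
apply: (@bounded_Lfun2 _ _ _ _ _ 1).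
  apply: measurable_maxr => //; apply: measurable_minr => //.
  by apply: measurable_funM => //; apply: measurable_funB.
by move=> w; rewrite ler_norml; case: (clip_cases ((X i w - c) / e)); lra.
Qed.

(** Replacing the indicator by a clipped linear function of slope [e^-1] costs
the mass of an interval of length [e]; the clipped function is dominated by
[X / e], so its covariances are at most [e ^- 2] times those of [X]. *)
Lemma ind_cov_smoothing k x (e : R) : (0 < k)%N -> 0 < e ->
  ind_cov X k x <= e ^- 2 * rcov P (X 0%N) (X k) + 2 * M * e.
Proof.
move=> k0 e0; have ie0 : 0 < e^-1 by rewrite invr_gt0.
pose g u := clip ((u - x) / e).
have scale u v : u <= v -> (u - x) / e <= (v - x) / e.
  by move=> uv; rewrite ler_pM2r// lerB.
have gm : {homo g : u v / u <= v}.
  by move=> u v /scale /clip_mono /andP[]; rewrite subr_ge0.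
have dm : {homo (fun u => e^-1 * u - g u) : u v / u <= v}.
  move=> u v /scale /clip_mono /andP[_]; rewrite /g; lra.
have G0 := clip_Lfun2 0 x e; have Gk := clip_Lfun2 k x e.
have Dk i : (fun w => e^-1 * X i w - g (X i w)) \in Lfun P 2%:E.
  rewrite (_ : (fun w => _) = (fun w => e^-1 * X i w + (-1) * g (X i w))).
    by apply: Lfun2D; apply: Lfun2Z => //; exact: clip_Lfun2.
  by apply/funext => w; rewrite mulN1r.
have c1 : rcov P (fun w => g (X 0%N w)) (fun w => g (X k w)) <=
    e^-1 * rcov P (X 0%N) (fun w => g (X k w)).
  have := assoc_pair k0 dm gm (Dk 0%N) Gk.
  by rewrite (rcovBl (X2 0) G0 Gk) subr_ge0.
have c2 : rcov P (X 0%N) (fun w => g (X k w)) <= e^-1 * rcov P (X 0%N) (X k).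
  have := assoc_pair (g := id) k0 (fun _ _ => id) dm (X2 0) (Dk k).
  by rewrite rcovC (rcovBl (X2 k) Gk (X2 0)) !(rcovC _ (X 0%N)) subr_ge0.
have c3 : rcov P (fun w => g (X 0%N w)) (fun w => g (X k w)) <=
    e ^- 2 * rcov P (X 0%N) (X k).
  apply: (le_trans c1); rewrite expr2 invfM -mulrA.
  by rewrite ler_wpM2l// ltW.
have I2 i z := ind_le_Lfun2 X i z.
have g1 i : rE P (ind_le (X i) x) + rE P (fun w => g (X i w)) <= M * e.
  have Gi := Lfun21 (clip_Lfun2 i x e).
  rewrite -(rED (Lfun21 (I2 i x)) Gi).
  apply: (@le_trans _ _ (F x - F (x - e))).
    rewrite lerBrDr (distr_fun_rE i x) (distr_fun_rE i (x - e)).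
    rewrite -rED; [|by apply: rpredD => //; exact/Lfun21/I2|exact/Lfun21/I2].
    apply: rE_le; [|exact/Lfun21/I2|].
      by apply: rpredD; [apply: rpredD|]; do ?exact/Lfun21/I2.
    move=> w; rewrite !ind_leE.
    have [h1 h2 h3 h4 _] := clip_cases ((X i w - x) / e).
    have xe : x - e <= x by rewrite gerBl ltW.
    case: (lerP (X i w) (x - e)) => a.
      rewrite (le_trans a xe) /g h4; first by rewrite /= mulr1n; lra.
      by rewrite ler_pdivrMr//; lra.
    case: (lerP (X i w) x) => b.
      by rewrite /g /= mulr1n mulr0n; lra.
    rewrite /g h3; first by rewrite /= mulr0n; lra.
    by rewrite divr_ge0 ?(ltW e0)// subr_ge0 ltW.
  by rewrite (le_trans (distr_fun_lip _))// ?gerBl ?(ltW e0)//; lra.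
have p1 : rE P (fun w => ind_le (X 0%N) x w * ind_le (X k) x w) <=
   rE P (fun w => g (X 0%N w) * g (X k w)) +
   (rE P (ind_le (X 0%N) x) + rE P (fun w => g (X 0%N w))) +
   (rE P (ind_le (X k) x) + rE P (fun w => g (X k w))).
  have D u v : u \in Lfun P 1 -> v \in Lfun P 1 ->
    (fun w => u w + v w) \in Lfun P 1 by move=> ? ?; exact: rpredD.
  have L0 := Lfun21 (I2 0%N x); have Lk := Lfun21 (I2 k x).
  have M0 := Lfun21 G0; have Mk := Lfun21 Gk.
  have GG := Lfun2_mul_Lfun1 G0 Gk.
  rewrite -(rED L0 M0) -(rED Lk Mk) -(rED GG (D _ _ L0 M0)).
  rewrite -(rED (D _ _ GG (D _ _ L0 M0)) (D _ _ Lk Mk)).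
  apply: rE_le => //.
  - exact: (Lfun2_mul_Lfun1 (I2 0%N x) (I2 k x)).
  - exact: (D _ _ (D _ _ GG (D _ _ L0 M0)) (D _ _ Lk Mk)).
  have bnd i w : [/\ -1 <= g (X i w), g (X i w) <= 0 &
      - g (X i w) <= ind_le (X i) x w <= 1].
    have [h1 h2 h3 _ _] := clip_cases ((X i w - x) / e).
    rewrite ind_leE; split=> //; case: (lerP (X i w) x) => a.
      by rewrite mulr1n lexx andbT; rewrite /g; lra.
    rewrite /g h3 ?oppr0 ?lexx ?ler01//.
    by rewrite divr_ge0 ?(ltW e0)// subr_ge0 ltW.
  have aux (p q u v : R) : - u <= p -> p <= 1 -> - v <= q -> -1 <= v ->
      p * q <= u * v + (p + u) + (q + v).
    move=> up p1 vq v1.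
    have : 0 <= (1 - p) * (q + v) by rewrite mulr_ge0//; lra.
    have : 0 <= (1 + v) * (p + u) by rewrite mulr_ge0//; lra.
    lra.
  move=> w /=; have [_ _ /andP[? ?]] := bnd 0%N w.
  by have [? _ /andP[? ?]] := bnd k w; exact: aux.
have p2 : rE P (fun w => g (X 0%N w)) * rE P (fun w => g (X k w)) <=
   rE P (ind_le (X 0%N) x) * rE P (ind_le (X k) x).
  have neg i : 0 <= - rE P (fun w => g (X i w)) <= rE P (ind_le (X i) x).
    have Gi := Lfun21 (clip_Lfun2 i x e).
    have [a b] : (forall w, g (X i w) <= 0) /\
        (forall w, 0 <= ind_le (X i) x w + g (X i w)).
      split=> w; have [h1 h2 h3 _ _] := clip_cases ((X i w - x) / e) => //.
      rewrite ind_leE; case: (lerP (X i w) x) => a.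
        by rewrite mulr1n /g; lra.
      rewrite /g h3 ?mulr0n ?addr0//.
      by rewrite divr_ge0 ?(ltW e0)// subr_ge0 ltW.
    have := rE_ge0 P b; rewrite (rED (Lfun21 (I2 i x)) Gi) => b'.
    have NL : (fun w => -1 * g (X i w)) \in Lfun P 1.
      by apply/Lfun21/Lfun2Z/clip_Lfun2.
    have := rE_ge0 P (f := fun w => -1 * g (X i w)).
    rewrite (rEZ _ Gi) mulN1r => /(_ (fun w => _)) a'.
    apply/andP; split; last by lra.
    by apply: a' => w; rewrite mulN1r oppr_ge0.
  have /andP[? ?] := neg 0%N; have /andP[? ?] := neg k.
  by rewrite -mulrNN ler_pM.
have := g1 0%N; have := g1 k; move: c3; rewrite /ind_cov /rcov => ? ? ?; lra.
Qed.

(** The scale [e = expR (- (a / 3) * k)] balances [e ^- 2 * expR (- a * k)]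
against [e]. *)
Lemma ind_cov_decay k x (a0 a : R) : (0 < k)%N ->
  (covariance P (X 0%N) (X k) <= (a0 * expR (- a * k%:R))%:E)%E ->
  ind_cov X k x <= (a0 + 2 * M) * expR (- (a / 3) * k%:R).
Proof.
move=> k0; rewrite (rcovE (X2 0) (X2 k)) lee_fin => h.
set e := expR (- (a / 3) * k%:R); have e0 : 0 < e by exact: expR_gt0.
have e3 : expR (- a * k%:R) = e ^+ 3.
  by rewrite /e -expRM_natl; congr expR; field.
apply: (le_trans (ind_cov_smoothing x k0 e0)).
suff : e ^- 2 * rcov P (X 0%N) (X k) <= a0 * e by lra.
rewrite e3 in h; rewrite mulrC ler_pdivrMr ?exprn_gt0//.
by rewrite (le_trans h)// -mulrA -exprS.
Qed.

End IndicatorCovariances.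

(** * Quantiles *)

Section Quantiles.
Variable R : realType.
Implicit Types (G : R -> R) (p x y : R).

(** Right-continuity, in the form that [G x < p] persists slightly to the right of
[x], makes the infimum that defines the quantile a minimum; the last two
hypotheses make the set nonempty and bounded below. *)
Lemma quantile_leP G p x :
  {homo G : x y / x <= y} ->
  (forall x, G x < p -> exists2 e, 0 < e & G (x + e) < p) ->
  (exists y, p <= G y) -> (exists y, G y < p) ->
  (quantile G p <= x) = (p <= G x).
Proof.
move=> mG rG [b bp] [l lp].
have lb y : G y < p -> lbound [set x | p <= G x] y.
  move=> yp z /= zp; rewrite leNgt; apply/negP => zy.
  by have := mG _ _ (ltW zy); rewrite leNgt (lt_le_trans yp zp).
apply/idP/idP => [|px]; last by apply: ge_inf => //; exists l; exact: lb.
apply: contraTT; rewrite -!ltNge => /rG[e e0 xe].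
apply: (@lt_le_trans _ _ (x + e)); first by rewrite ltrDl.
by apply: lb_le_inf; [exists b|exact: lb].
Qed.

Lemma quantile_lip G p (M : R) : {homo G : x y / x <= y} ->
  (forall x y, x <= y -> G y - G x <= M * (y - x)) -> 0 <= M ->
  (exists y, p <= G y) -> (exists y, G y < p) -> G (quantile G p) = p.
Proof.
move=> mG lG M0 ub lb.
(* within a distance [e] of [x] the function moves by less than [`|G x - c|] *)
have step x c : c < G x \/ G x < c ->
    exists2 e, 0 < e & (c < G x -> c < G (x - e)) /\ (G x < c -> G (x + e) < c).
  move=> cx; pose e := `|G x - c| / (2 * (M + 1)).
  have M1 : 0 < 2 * (M + 1) by rewrite mulr_gt0// ltr_wpDl.
  have g0 : 0 < `|G x - c|.
    by rewrite normr_gt0 subr_eq0; case: cx => [/gt_eqF ->|/lt_eqF ->].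
  have e0 : 0 < e by rewrite divr_gt0.
  have Me : M * e < `|G x - c|.
    have -> : `|G x - c| = 2 * (M + 1) * e.
      by rewrite /e mulrC divfK// gt_eqF.
    nra.
  exists e => //; split=> h.
    have := lG (x - e) x; rewrite gerBl (ltW e0) subKr => /(_ isT).
    by move: Me; rewrite gtr0_norm ?subr_gt0//; lra.
  have := lG x (x + e); rewrite lerDl (ltW e0) addrAC subrr add0r => /(_ isT).
  by move: Me; rewrite ltr0_norm ?subr_lt0//; lra.
have rG x : G x < p -> exists2 e, 0 < e & G (x + e) < p.
  move=> xp; have [|e e0 [_ h]] := step x p; first by right.
  by exists e => //; exact: h.
have qP x := quantile_leP x mG rG ub lb.
apply/eqP; rewrite eq_le; apply/andP; split; last by rewrite -qP.
rewrite leNgt; apply/negP => h; have [e e0 [/(_ h) h' _]] := step _ _ (or_introl h).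
by have := ltW h'; rewrite -qP leNgt gtrBl e0.
Qed.

End Quantiles.

Section SampleQuantile.
Context d (T : measurableType d) (R : realType) (P : probability T R).
Variable X : nat -> {RV P >-> R}.
Variables (n : nat) (p : R) (w : T).
Hypotheses (n_gt0 : (0 < n)%N) (p_gt0 : 0 < p) (p_lt1 : p < 1).

Lemma empiricalE y : empirical_distr_fun X n w y =
  n%:R^-1 * \sum_(i < n) (X i w <= y)%R%:R.
Proof. by congr (_ * _); apply: eq_bigr => i _; rewrite ind_leE. Qed.

(** There is a gap between a point and the next observation on its right, which
is the right-continuity of the empirical distribution function. *)
Lemma sample_gap (x : R) (k : nat) : exists2 e, 0 < e &
  forall i, (i < k)%N -> X i w <= x + e -> X i w <= x.
Proof.
elim: k => [|k [e e0 IH]]; first by exists 1.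
case: (lerP (X k w) x) => h.
  by exists e => // i; rewrite ltnS leq_eqVlt => /predU1P[->//|/IH].
exists (Num.min e ((X k w - x) / 2)).
  by rewrite lt_min e0/= divr_gt0// subr_gt0.
move=> i; rewrite ltnS leq_eqVlt => /predU1P[->|/IH ik].
  move=> Xk; have : X k w <= x + (X k w - x) / 2.
    by rewrite (le_trans Xk)// lerD2l ge_min lexx orbT.
  lra.
by move=> Xi; apply: ik; rewrite (le_trans Xi)// lerD2l ge_min lexx.
Qed.

Lemma sample_quantile_leP x :
  (sample_quantile X n p w <= x) = (p <= empirical_distr_fun X n w x).
Proof.
have n0 : 0 < n%:R :> R by rewrite ltr0n.
have Xb (i : 'I_n) : `|X i w| <= \sum_(j < n) `|X j w|.
  by rewrite (bigD1 i)//= lerDl sumr_ge0.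
apply: quantile_leP.
- move=> y z yz; rewrite !empiricalE ler_wpM2l ?invr_ge0 ?(ltW n0)//.
  apply: ler_sum => i _; rewrite ler_nat.
  by case: (boolP (X i w <= y)) => // h; rewrite (le_trans h yz).
- move=> y yp; have [e e0 he] := sample_gap y n.
  exists e => //; apply: le_lt_trans yp; rewrite !empiricalE.
  rewrite ler_wpM2l ?invr_ge0 ?(ltW n0)//; apply: ler_sum => i _; rewrite ler_nat.
  by case: (boolP (X i w <= y + e)) => // h; rewrite he.
- exists (\sum_(j < n) `|X j w|); rewrite empiricalE.
  rewrite (eq_bigr (fun=> 1)); last first.
    by move=> i _; rewrite (le_trans (ler_norm _) (Xb i)).
  by rewrite sumr_const card_ord mulVf ?gt_eqF// ltW.
- exists (- (\sum_(j < n) `|X j w|) - 1); rewrite empiricalE big1 ?mulr0// => i _.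
  rewrite leNgt (_ : _ < _) //; have := Xb i; rewrite ler_norml => /andP[? _]; lra.
Qed.

End SampleQuantile.

(** * Summation of the covariances *)

Definition partial_sum (R : realType) (u : nat -> R) (j : nat) : R :=
  \sum_(1 <= k < j.+1) u k.

(** Adding one index to the square adds a diagonal term and two copies of a
partial sum. *)
Lemma double_sum (R : realType) (u : nat -> R) n :
  \sum_(i < n) \sum_(j < n) u (i - j + (j - i))%N =
  n%:R * u 0%N + 2 * \sum_(i < n) partial_sum u i.
Proof.
elim: n => [|n IH]; first by rewrite !big_ord0 mul0r mulr0 addr0.
have row : \sum_(j < n) u (n - j + (j - n))%N = partial_sum u n.
  rewrite /partial_sum big_add1 /= big_nat_rev /= add0n big_mkord.
  by apply: eq_bigr => j _; congr u; have := ltn_ord j; lia.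
rewrite big_ord_recr/= big_ord_recr/= row subnn.
under eq_bigr => i _ do rewrite big_ord_recr/=.
rewrite big_split/= IH [in LHS](eq_bigr (fun i : 'I_n => u (n - i + (i - n))%N)).
  by rewrite row big_ord_recr/= -natr1; ring.
by move=> i _; rewrite addnC.
Qed.

Section Series.
Variable R : realType.
Variables (u : nat -> R) (c r : R).
Hypothesis u_ge0 : forall k, 0 <= u k.
Hypotheses (r_gt0 : 0 < r) (r_lt1 : r < 1) (c_ge0 : 0 <= c).
Hypothesis u_le : forall k, (0 < k)%N -> u k <= c * r ^+ k.

Lemma geometric_tail N K : (0 < N)%N ->
  \sum_(N <= k < K) u k <= c / (1 - r) * r ^+ N.
Proof.
move=> N0; have r1 : 0 < 1 - r by rewrite subr_gt0.
have cr : 0 <= c / (1 - r) by rewrite divr_ge0// ltW.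
suff H k : \sum_(N <= k < N + k) u k <= c / (1 - r) * (r ^+ N - r ^+ (N + k)).
  case: (leqP N K) => [NK|KN]; last first.
    by rewrite big_geq 1?ltnW// mulr_ge0// exprn_ge0// ltW.
  rewrite -(subnKC NK); apply: (le_trans (H _)).
  by rewrite ler_wpM2l// gerBl exprn_ge0// ltW.
elim: k => [|k IH]; first by rewrite addn0 big_geq// subrr mulr0.
rewrite addnS big_nat_recr ?leq_addr//=.
have := u_le (ltn_addr k N0); rewrite exprS => uk.
have e : c * r ^+ (N + k) = c / (1 - r) * (r ^+ (N + k) - r * r ^+ (N + k)).
  by field; rewrite gt_eqF.
rewrite e in uk; move: IH uk; set z := r ^+ (N + k); lra.
Qed.

Lemma series_sum : exists2 G : R,
  (\sum_(1 <= j <oo) (u j)%:E)%E = G%:E &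
  forall i, 0 <= G - partial_sum u i <= c / (1 - r) * r ^+ i.
Proof.
have r1 : 0 < 1 - r by rewrite subr_gt0.
have cr : 0 <= c / (1 - r) by rewrite divr_ge0// ltW.
have ge0 N : (0 <= \sum_(N <= j <oo) (u j)%:E)%E.
  by apply: nneseries_ge0 => k _ _; rewrite lee_fin.
have tail i : (\sum_(1 + i <= j <oo) (u j)%:E <= (c / (1 - r) * r ^+ i)%:E)%E.
  apply: lime_le; first by apply: is_cvg_nneseries => k _ _; rewrite lee_fin.
  apply: nearW => K; rewrite sumEFin lee_fin.
  apply: (le_trans (geometric_tail _ (ltn_addr i _)))=> //.
  by rewrite exprS ler_wpM2l// ler_piMl ?exprn_ge0// ltW.
have split i : (\sum_(1 <= j <oo) (u j)%:E =
    (partial_sum u i)%:E + \sum_(1 + i <= j <oo) (u j)%:E)%E.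
  by rewrite (nneseries_split 1 i)//= ?sumEFin// => k _; rewrite lee_fin.
have tfin i : (\sum_(1 + i <= j <oo) (u j)%:E)%E \is a fin_num.
  by rewrite ge0_fin_numE// (le_lt_trans (tail i))// ltry.
exists (fine (\sum_(1 <= j <oo) (u j)%:E)%E).
  by rewrite fineK// -[1%N]addn0.
move=> i; rewrite (split i) -(fineK (tfin i)) -EFinD/= addrAC subrr add0r.
by rewrite fine_ge0//= -lee_fin fineK.
Qed.

End Series.

(** * Second-order expansion *)

(** Two applications of the mean value theorem, to the function and to its
derivative. *)
Lemma second_order_expansion (R : realType) (F : R -> R) (x0 : R) :
  bounded_second_derivative_near F x0 ->
  exists M eta : R, [/\ 0 <= M, 0 < eta & forall x, `|x - x0| < eta ->
    `|F x - F x0 - F^`()%classic x0 * (x - x0)| <= M * (x - x0) ^+ 2].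
Proof.
move=> [M /nbhs_ballP[eta /= eta0 H]].
have {}H x : `|x - x0| < eta ->
  [/\ derivable F x 1, derivable F^`()%classic x 1 & `|F^`(2)%classic x| <= M].
  by move=> xe; apply: H; rewrite /ball/= distrC.
have mvt (g : R -> R) a b : `|a - x0| < eta -> `|b - x0| < eta -> a <= b ->
    (forall x, `|x - x0| < eta -> derivable g x 1) ->
    exists2 c, a <= c <= b & g b - g a = g^`()%classic c * (b - a).
  move=> ae be ab dg.
  have inab z : z \in `[a, b] -> `|z - x0| < eta.
    rewrite in_itv/= => /andP[az zb].
    by move: ae be; rewrite !ltr_norml => /andP[? ?] /andP[? ?]; lra.
  have dg' z : z \in `]a, b[ -> is_derive z 1 g (g^`()%classic z).
    move=> zab; rewrite derive1E; apply: derivableP; apply: dg; apply: inab.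
    by move: zab; rewrite !in_itv/= => /andP[/ltW -> /ltW ->].
  have cg : {within `[a, b], continuous g}.
    by apply: derivable_within_continuous => z zab; apply: dg; exact: inab.
  have [c cab e] := @MVT_segment R g g^`()%classic a b ab dg' cg.
  by exists c => //; move: cab; rewrite in_itv.
have x0e : `|x0 - x0| < eta by rewrite subrr normr0.
have M0 : 0 <= M by have [_ _] := H x0 x0e; exact: le_trans.
have D1 z : `|z - x0| < eta -> derivable F z 1 by case/H.
have D2 z : `|z - x0| < eta -> derivable F^`()%classic z 1 by case/H.
have D3 z : `|z - x0| < eta -> `|F^`()%classic^`()%classic z| <= M.
  by case/H => _ _; rewrite derive1nS derive1n1.
have sq b y : `|b| <= M -> `|b * y| <= M * `|y|.
  by move=> bM; rewrite normrM ler_wpM2r.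
exists M, eta; split=> // x xe; rewrite -(real_normK (num_real (x - x0))).
have fin c : `|c - x0| <= `|x - x0| -> F x - F x0 = F^`()%classic c * (x - x0) ->
    `|F^`()%classic c - F^`()%classic x0| <= M * `|c - x0| ->
    `|F x - F x0 - F^`()%classic x0 * (x - x0)| <= M * `|x - x0| ^+ 2.
  move=> cx -> fc; rewrite -mulrBl normrM expr2 mulrA ler_wpM2r//.
  by rewrite (le_trans fc)// ler_wpM2l.
case: (leP x0 x) => x0x.
  have [c /andP[c1 c2] e] := mvt F _ _ x0e xe x0x D1.
  have ce : `|c - x0| < eta.
    by move: xe; rewrite !ltr_norml => /andP[? ?]; apply/andP; split; lra.
  have [c' /andP[c1' c2'] e'] := mvt _ _ _ x0e ce c1 D2.
  apply: (fin c) => //; first by rewrite !ger0_norm ?subr_ge0//; lra.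
  rewrite e' sq// D3//.
  by move: ce; rewrite !ltr_norml => /andP[? ?]; apply/andP; split; lra.
have [c /andP[c1 c2] e] := mvt F _ _ xe x0e (ltW x0x) D1.
have ce : `|c - x0| < eta.
  by move: xe; rewrite !ltr_norml => /andP[? ?]; apply/andP; split; lra.
have [c' /andP[c1' c2'] e'] := mvt _ _ _ ce x0e c2 D2.
apply: (fin c); first by rewrite !ler0_norm ?subr_le0//; lra.
  by rewrite -[LHS]opprB e; ring.
rewrite distrC e' [`|c - x0|]distrC sq// D3//.
by move: ce; rewrite !ltr_norml => /andP[? ?]; apply/andP; split; lra.
Qed.

(** * Normal approximation of the sample quantile at a fixed point *)

Lemma within_far n m (i j : 'I_n) : ~~ within m i j -> (m < i - j + (j - i))%N.
Proof. by rewrite /within; lia. Qed.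

Section FixedPoint.
Context d (T : measurableType d) (R : realType) (P : probability T R).
Variable X : nat -> {RV P >-> R}.
Hypothesis statX : strictly_stationary X.
Hypothesis assocX : associated X.
Variables (c r : R).
Hypotheses (c_ge0 : 0 <= c) (r_gt0 : 0 < r) (r_lt1 : r < 1).
Hypothesis ind_cov_le : forall k x, (0 < k)%N -> ind_cov X k x <= c * r ^+ k.
Implicit Types x p : R.

Local Notation F := (distr_fun (X 0%N)).

Definition count_variance n x : R :=
  \sum_(i < n) \sum_(j < n) ind_cov X (i - j + (j - i)) x.

Lemma cov_bit_dist n x (i j : 'I_n) :
  cov (exceed_law X n x) (bit R i) (bit R j) = ind_cov X (i - j + (j - i)) x.
Proof.
case: (leqP i j) => ij.
  by rewrite (cov_bit_shift statX x ij) (eqP (ij : (i - j == 0)%N)).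
rewrite covC (cov_bit_shift statX x (ltnW ij)).
by rewrite (eqP (ltnW ij : (j - i == 0)%N)) addn0.
Qed.

Lemma mean_bit n x (i : 'I_n) : Ex (exceed_law X n x) (bit R i) = 1 - F x.
Proof.
have lw := exceed_law_is_law X n x.
have := distr_fun_rE statX i x; rewrite ind_le_exceed.
rewrite (rE_exceed X x (fun b => 1 - bit R i b)) ExB Ex_cst// => ->.
by rewrite subKr.
Qed.

(** By [sample_quantile_leP] the event says that at most [n * (1 - p)] bits equal
one; centering the bits at [1 - F x] gives the threshold. *)
Lemma quantile_event n x p (h : R) : (0 < n)%N -> 0 < p -> p < 1 -> 0 < h ->
  fine (P [set w | sample_quantile X n p w <= x]) =
  Ex (exceed_law X n x)
    (fun b => (stdsum (exceed_law X n x) h b <= h * (n%:R * (F x - p)))%R%:R).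
Proof.
move=> n0 p0 p1 h0.
pose Q (b : {ffun 'I_n -> bool}) :=
  stdsum (exceed_law X n x) h b <= h * (n%:R * (F x - p)).
rewrite -(exceed_event X x Q); congr (fine (P _)); apply/seteqP.
have nR : 0 < n%:R :> R by rewrite ltr0n.
suff H w : (sample_quantile X n p w <= x) = Q (exceed X n x w).
  by split=> w /=; rewrite H.
rewrite sample_quantile_leP// /Q /stdsum ler_pM2l// sumrB.
under [X in _ - X]eq_bigr do rewrite mean_bit.
rewrite sumr_const card_ord -[_ *+ n]mulr_natl.
have -> : empirical_distr_fun X n w x =
    n%:R^-1 * (n%:R - \sum_i bit R i (exceed X n x w)).
  congr (_ * _); rewrite (eq_bigr (fun i : 'I_n => 1 - bit R i (exceed X n x w))).
    by rewrite sumrB sumr_const card_ord.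
  move=> i _; by rewrite (ind_le_exceed X x i).
rewrite mulrC ler_pdivlMr//; apply/idP/idP; lra.
Qed.

(** The covariances are nonnegative, so the diagonal is a lower bound. *)
Lemma count_variance_ge n x (v : R) : v <= F x * (1 - F x) ->
  n%:R * v <= count_variance n x.
Proof.
move=> vF; rewrite /count_variance.
apply: (@le_trans _ _ (\sum_(i < n) v)).
  by rewrite sumr_const card_ord mulr_natl.
apply: ler_sum => i _; rewrite (bigD1 i)//= subnn addn0 ind_cov0//.
by rewrite (le_trans vF)// lerDl sumr_ge0// => j _; exact: ind_cov_ge0.
Qed.

(** The terms come from [h ^+ 2], from [h * L] and from the error in Stein's
identity, with [h] at most [(Num.sqrt (n * v))^-1]. *)
Definition be_const (v : R) : R :=
  2 * (v^-1 + (18 + tail_bound R) * (Num.sqrt v)^-1 + 70 * v^-1).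

Lemma be_const_ge0 (v : R) : 0 < v -> 0 <= be_const v.
Proof.
move=> v0; rewrite /be_const.
have C0 : 0 <= tail_bound R by rewrite invr_ge0 ltW// phi_gt0.
have A0 : 0 <= (Num.sqrt v)^-1 by rewrite invr_ge0 sqrtr_ge0.
have : 0 <= (18 + tail_bound R) * (Num.sqrt v)^-1 by rewrite mulr_ge0// addr_ge0.
have : 0 <= v^-1 by rewrite invr_ge0 ltW.
lra.
Qed.

Lemma quantile_normal_approx n m x p (v : R) :
  0 < p -> p < 1 -> 0 < v -> v <= F x * (1 - F x) -> 2 <= n%:R * v ->
  n%:R ^+ 2 * (2 * m).+1%:R ^+ 2 * (c * r ^+ m) <= 1 ->
  `|fine (P [set w | sample_quantile X n p w <= x]) -
    ncdf (n%:R * (F x - p) / Num.sqrt (count_variance n x))| <=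
  be_const v * ((2 * m).+1%:R ^+ 2 / Num.sqrt n%:R).
Proof.
move=> p0 p1 v0 vF nv small; set L := (2 * m).+1%:R; rewrite -/L in small.
have n0 : (0 < n)%N by case: n nv {small} => //; rewrite mul0r; lra.
have nR : 1 <= n%:R :> R by rewrite ler1n.
have L1 : 1 <= L by rewrite ler1n.
have Vge := count_variance_ge n vF.
set V := count_variance n x in Vge *.
have V0 : 0 < V by lra.
set h := (Num.sqrt V)^-1.
have h0 : 0 < h by rewrite invr_gt0 sqrtr_gt0.
have h2 : h ^+ 2 = V^-1 by rewrite exprVn sqr_sqrtr ?(ltW V0).
rewrite (quantile_event x n0 p0 p1 h0) [_ / Num.sqrt V]mulrC -/h.
have lw := exceed_law_is_law X n x.
have aw := @exceed_law_assoc _ _ _ _ X n x assocX.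
have far (i j : 'I_n) : ~~ within m i j ->
    cov (exceed_law X n x) (bit R i) (bit R j) <= c * r ^+ m.
  move=> ij; rewrite cov_bit_dist.
  have k0 := within_far ij.
  rewrite (le_trans (ind_cov_le x (leq_ltn_trans (leq0n _) k0)))//.
  rewrite ler_wpM2l// -[in leLHS](subnKC (ltnW k0)) exprD.
  rewrite ler_piMr ?exprn_ge0 ?(ltW r_gt0)//.
  by apply: exprn_ile1; exact: ltW.
have uv : h ^+ 2 * (\sum_i \sum_j cov (exceed_law X n x) (bit R i) (bit R j)) = 1.
  under eq_bigr do under eq_bigr do rewrite cov_bit_dist.
  by rewrite -/(count_variance n x) -/V h2 mulVf// gt_eqF.
have rho0 : 0 <= c * r ^+ m by rewrite mulr_ge0 ?exprn_ge0 ?(ltW r_gt0).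
have hV : h ^+ 2 <= v^-1 / n%:R.
  rewrite h2 -invfM lef_pV2 ?posrE//; first by rewrite mulrC.
  by rewrite mulr_gt0// ltr0n.
have hs : h ^+ 2 <= 2^-1.
  by rewrite h2 lef_pV2 ?posrE//; lra.
have C0 : 0 <= tail_bound R by rewrite invr_ge0 ltW// phi_gt0.
set z := h * _.
have z01 : 0 <= ncdf z <= 1 by rewrite ncdf_ge0 ncdf_le1.
have sa := @stein_approximation R n m _ h (c * r ^+ m) lw aw h0 rho0 n0 far small uv hs
  z (ncdf z) (tail_bound R) (stein_sol z) z01 (stein_sol_lip z) (stein_sol_bound z)
  (stein_sol_mul_bound z) (stein_sol_eq (z := z)).
apply: (le_trans sa) => {sa}.
rewrite /be_const -/L -mulrA ler_pM2l// /stein_error -/L.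
set s := Num.sqrt n%:R; have s0 : 0 < s by rewrite sqrtr_gt0 ltr0n.
have s2 : s ^+ 2 = n%:R by rewrite sqr_sqrtr.
have s1 : 1 <= s by rewrite -sqrtr1 ler_wsqrtr.
set iv := v^-1 in hV *; have iv0 : 0 < iv by rewrite invr_gt0.
set A := (Num.sqrt v)^-1; have A0 : 0 < A by rewrite invr_gt0 sqrtr_gt0.
have A2 : A ^+ 2 = iv by rewrite exprVn sqr_sqrtr ?(ltW v0).
have hA : h <= A / s.
  rewrite -(@ler_pXn2r _ 2) ?nnegrE ?divr_ge0 ?(ltW A0) ?(ltW h0) ?(ltW s0)//.
  by rewrite expr_div_n A2 s2.
have L2 : L <= L ^+ 2 by rewrite expr2 ler_peMl// (le_trans ler01).
have LL : 1 <= L ^+ 2 by exact: le_trans L2.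
have t1 : h ^+ 2 <= iv * (L ^+ 2 / s).
  apply: (le_trans hV); rewrite ler_pM2l// -s2 expr2 invfM.
  apply: (@le_trans _ _ (1 / s)); last by rewrite ler_pM2r ?invr_gt0.
  by rewrite ler_pM2r ?invr_gt0// invf_le1.
have t2 : h * L <= A * (L ^+ 2 / s).
  apply: (le_trans (ler_wpM2r (le_trans ler01 L1) hA)).
  by rewrite -mulrA ler_pM2l// mulrC ler_pM2r ?invr_gt0.
have t3 : h ^+ 2 * s * L ^+ 2 <= iv * (L ^+ 2 / s).
  rewrite (_ : iv * _ = (iv / n%:R * s) * L ^+ 2).
    by rewrite ler_wpM2r ?sqr_ge0// ler_wpM2r// ltW.
  by rewrite -s2; field; rewrite gt_eqF.
have : (18 + tail_bound R) * (h * L) <= (18 + tail_bound R) * (A * (L ^+ 2 / s)).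
  by rewrite ler_wpM2l// addr_ge0.
lra.
Qed.

End FixedPoint.

(** * Comparison of variances and the uniform bound *)

Lemma geometric_sum_le (R : realType) (r : R) n : 0 < r -> r < 1 ->
  \sum_(i < n) r ^+ i <= (1 - r)^-1.
Proof.
move=> r0 r1; have r1' : 0 < 1 - r by rewrite subr_gt0.
suff -> : \sum_(i < n) r ^+ i = (1 - r ^+ n) / (1 - r).
  rewrite ler_pdivrMr// mulVf ?gt_eqF// gerBl exprn_ge0// ltW//.
elim: n => [|n IH]; first by rewrite big_ord0 expr0 subrr mul0r.
rewrite big_ord_recr/= IH exprS; field; by rewrite gt_eqF.
Qed.

(** The difference of two square roots is at most the difference of the squares
divided by one of the roots, here [Num.sqrt V]. *)
Lemma standardized_shift (R : realType) (N V s2 t e v B E : R) :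
  0 < N -> 0 < v -> 0 <= s2 -> N * v <= V -> `|V - N * s2| <= B -> `|e| <= E ->
  `|(t * (Num.sqrt N * Num.sqrt s2) + e) / Num.sqrt V - t| <=
    `|t| * (B / (N * v)) + E / (Num.sqrt N * Num.sqrt v).
Proof.
move=> N0 v0 s0 NV VB eE.
have Nv : 0 < N * v by rewrite mulr_gt0.
have V0 : 0 < V by exact: lt_le_trans NV.
set w := Num.sqrt V; have w0 : 0 < w by rewrite sqrtr_gt0.
set u := _ * Num.sqrt s2; have u0 : 0 <= u by rewrite mulr_ge0 ?sqrtr_ge0.
have w2 : w ^+ 2 = V by rewrite sqr_sqrtr// ltW.
have u2 : u ^+ 2 = N * s2 by rewrite exprMn !sqr_sqrtr// ltW.
have E0 : 0 <= E by exact: le_trans eE.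
have B0 : 0 <= B by exact: le_trans VB.
have uw : `|u - w| / w <= B / (N * v).
  apply: (@le_trans _ _ (B / V)); last by rewrite ler_wpM2l// lef_pV2.
  rewrite ler_pdivrMr// -w2 expr2 invfM mulrA mulfVK ?gt_eqF//.
  rewrite ler_pdivlMr// (le_trans _ VB)// -w2 -u2.
  rewrite distrC subr_sqr normrM ler_wpM2l// ger0_norm ?addr_ge0 ?(ltW w0)//.
  by rewrite lerDl.
rewrite (_ : _ - t = t * ((u - w) / w) + e / w); last by field; rewrite gt_eqF.
rewrite (le_trans (ler_normD _ _))// lerD//.
  by rewrite normrM ler_wpM2l// normrM (gtr0_norm (_ : 0 < w^-1)) ?invr_gt0.
rewrite normrM (gtr0_norm (_ : 0 < w^-1)) ?invr_gt0// ler_pM// ?invr_ge0 ?(ltW w0)//.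
have sNv : 0 < Num.sqrt N * Num.sqrt v by rewrite mulr_gt0 ?sqrtr_gt0.
by rewrite lef_pV2// -sqrtrM ?(ltW N0)// ler_wsqrtr.
Qed.

Lemma measurable_sample_quantile d (T : measurableType d) (R : realType)
    (P : probability T R) (X : nat -> {RV P >-> R}) (n : nat) (p x : R) :
  (0 < n)%N -> 0 < p -> p < 1 ->
  measurable [set w | sample_quantile X n p w <= x].
Proof.
move=> n0 p0 p1.
rewrite (_ : [set w | _] =
    (fun w => empirical_distr_fun X n w x) @^-1` `[p, +oo[%classic).
  have mG : measurable_fun setT (fun w => empirical_distr_fun X n w x).
    rewrite /empirical_distr_fun; apply: measurable_funM => //.
    apply: measurable_sum => i; apply: measurable_indic.
    exact: measurable_le.
  by rewrite -[X in measurable X]setTI; exact: mG.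
by apply/seteqP; split => w /=; rewrite in_itv/= andbT sample_quantile_leP.
Qed.

Lemma rate_bound (R : realType) (n s l L t K M a c2 v M2 rho bc : R) :
  s ^+ 2 = n -> 1 <= s -> 1 <= l -> 0 <= L -> L <= K * l -> t ^+ 2 <= l ->
  0 <= M -> 0 <= a -> 0 <= c2 -> 0 < v -> 0 <= M2 -> 0 <= rho -> 0 <= bc ->
  n ^+ 2 * rho <= 1 ->
  bc * (L ^+ 2 / s) +
  (`|t| * ((n * (L * (2 * M * (`|t| * a / s)) + n * rho) + c2) / (n * v)) +
   M2 * (t * a) ^+ 2 / (s * Num.sqrt v)) <=
  (bc * K ^+ 2 + (2 * M * a * K + 1 + c2) / v + M2 * a ^+ 2 / Num.sqrt v) *
    (l ^+ 2 / s).
Proof.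
move=> sn s1 l1 L0 LK tl M0 a0 c20 v0 M20 rho0 bc0 nr.
have s0 : 0 < s by exact: lt_le_trans s1.
have l0 : 0 <= l by exact: le_trans l1.
have n1 : 1 <= n by rewrite -sn exprn_ege1.
have n0 : 0 < n by exact: lt_le_trans n1.
have sv : 0 < Num.sqrt v by rewrite sqrtr_gt0.
have ll : l <= l ^+ 2 by rewrite expr2 ler_peMl.
have t2 : `|t| ^+ 2 <= l by rewrite (real_normK (num_real t)).
have tl' : `|t| <= l.
  rewrite -(@ler_pXn2r _ 2) ?nnegrE//; exact: le_trans ll.
have T1 : bc * (L ^+ 2 / s) <= bc * K ^+ 2 * (l ^+ 2 / s).
  rewrite -mulrA ler_wpM2l// mulrA ler_pM2r ?invr_gt0// -exprMn.
  by rewrite ler_pXn2r ?nnegrE//; exact: le_trans LK.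
have T3 : M2 * (t * a) ^+ 2 / (s * Num.sqrt v) <=
    M2 * a ^+ 2 / Num.sqrt v * (l ^+ 2 / s).
  rewrite (_ : M2 * (t * a) ^+ 2 / (s * Num.sqrt v) =
    M2 * a ^+ 2 / Num.sqrt v * (t ^+ 2 / s)); last by field; rewrite !gt_eqF.
  rewrite ler_wpM2l ?divr_ge0 ?mulr_ge0 ?sqr_ge0 ?(ltW sv)//.
  by rewrite ler_pM2r ?invr_gt0//; exact: le_trans ll.
have T2 : `|t| * ((n * (L * (2 * M * (`|t| * a / s)) + n * rho) + c2) / (n * v)) <=
    (2 * M * a * K + 1 + c2) / v * (l ^+ 2 / s).
  have -> : `|t| * ((n * (L * (2 * M * (`|t| * a / s)) + n * rho) + c2) / (n * v)) =
     v^-1 * (2 * M * a * (L * `|t| ^+ 2 / s) + `|t| * (n * rho) + c2 * (`|t| / n)).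
    by field; rewrite !gt_eqF.
  have ts : `|t| / n <= l ^+ 2 / s.
    apply: ler_pM; rewrite ?invr_ge0 ?(ltW n0)//; first exact: le_trans ll.
    by rewrite lef_pV2// -sn expr2 ler_peMl// ltW.
  have tr : `|t| * (n * rho) <= l ^+ 2 / s.
    apply: le_trans ts; rewrite ler_wpM2l// -[leRHS]mul1r ler_pdivlMr//.
    by rewrite (_ : _ * n = n ^+ 2 * rho)//; ring.
  have tL : L * `|t| ^+ 2 / s <= K * (l ^+ 2 / s).
    rewrite mulrA ler_pM2r ?invr_gt0// (expr2 l) mulrA.
    by apply: ler_pM => //; exact: exprn_ge0.
  rewrite (_ : (2 * M * a * K + 1 + c2) / v * (l ^+ 2 / s) =
    v^-1 * (2 * M * a * (K * (l ^+ 2 / s)) + l ^+ 2 / s + c2 * (l ^+ 2 / s)));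
    last by field; rewrite !gt_eqF.
  rewrite ler_pM2l ?invr_gt0// !lerD//; first by rewrite ler_wpM2l// !mulr_ge0.
  by rewrite ler_wpM2l.
lra.
Qed.

Lemma quartic_ge (R : realType) (K l : R) : 0 <= K -> 1 <= l -> 256 * K <= l ->
  K * l <= (l / 4) ^+ 4.
Proof.
move=> K0 l1 Kl; have l0 : 0 <= l by exact: le_trans l1.
have h1 : 256 * K * l <= l * l by rewrite ler_wpM2r.
have h2 : l * l <= l * l * l ^+ 2 by rewrite ler_peMr ?mulr_ge0// exprn_ege1.
have -> : (l / 4) ^+ 4 = l * l * l ^+ 2 / 256 by field.
lra.
Qed.

Lemma quartic_lt_exp (R : realType) (l : R) : 0 <= l -> (l / 4) ^+ 4 < expR l.
Proof.
move=> l0; rewrite (_ : expR l = expR (l / 4) ^+ 4); last first.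
  by rewrite -expRM_natl; congr expR; field.
rewrite ltr_pXn2r ?nnegrE ?expR_ge0 ?divr_ge0//.
by have := expR_ge1Dx (l / 4); lra.
Qed.

(** For [m >= (5 / b) * ln n] the covariances beyond distance [m] are at most
[c * n ^- 5], which absorbs the factor [n ^+ 2 * L ^+ 2 <= n ^+ 4] and the
constant [c <= n]. *)
Lemma window_exists (R : realType) (b c l : R) (n : nat) : 0 < b -> 0 <= c ->
  n%:R = expR l -> 1 <= l -> c <= l -> 256 * (10 / b + 3) <= l ->
  exists m : nat, (2 * m).+1%:R <= (10 / b + 3) * l /\
    n%:R ^+ 2 * (2 * m).+1%:R ^+ 2 * (c * expR (- b) ^+ m) <= 1.
Proof.
move=> b0 c0 ln l1 cl Kl; set K := 10 / b + 3 in Kl *.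
have n0 : 0 < n%:R :> R by rewrite ln expR_gt0.
have nl : (l / 4) ^+ 4 <= n%:R.
  by rewrite ln ltW// quartic_lt_exp// (le_trans ler01).
have ln' : l <= n%:R by rewrite ln; have := expR_ge1Dx l; lra.
set y := 5 / b * l.
have y0 : 0 <= y by rewrite mulr_ge0 ?divr_ge0 ?(ltW b0)//; lra.
exists (Num.truncn y).+1.
set m := (Num.truncn y).+1.
have my : y <= m%:R by apply: ltW; exact: truncnS_gt.
have ym : m%:R <= y + 1.
  by rewrite -natr1 lerD2r; have /andP[] := truncn_itv y0.
have LK : (2 * m).+1%:R <= K * l.
  have -> : K * l = 2 * y + 3 * l by rewrite /K /y; field; rewrite gt_eqF.
  rewrite -natr1 natrM; lra.
split=> //.
have Ln : (2 * m).+1%:R <= n%:R :> R.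
  apply: (le_trans LK); apply: le_trans nl.
  apply: quartic_ge => //; rewrite addr_ge0// divr_ge0// ltW//.
have rm : expR (- b) ^+ m <= (n%:R ^+ 5)^-1.
  rewrite -expRM_natl ln -expRM_natl -expRN ler_expR mulrN lerN2.
  have : y * b <= m%:R * b by rewrite ler_pM2r.
  by rewrite /y mulrAC divfK ?gt_eqF.
have L0 : 0 <= (2 * m).+1%:R :> R by [].
apply: (@le_trans _ _ (n%:R ^+ 2 * n%:R ^+ 2 * (n%:R * (n%:R ^+ 5)^-1))).
  apply: ler_pM.
  - by rewrite mulr_ge0 ?sqr_ge0.
  - by rewrite mulr_ge0// exprn_ge0// expR_ge0.
  - by rewrite ler_wpM2l ?sqr_ge0// ler_pXn2r ?nnegrE.
  - by apply: ler_pM => //; rewrite ?exprn_ge0 ?expR_ge0//; exact: le_trans ln'.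
by rewrite le_eqVlt; apply/orP; left; apply/eqP; field; rewrite gt_eqF.
Qed.

Section VarianceComparison.
Context d (T : measurableType d) (R : realType) (P : probability T R).
Variable X : nat -> {RV P >-> R}.
Hypothesis statX : strictly_stationary X.
Hypothesis assocX : associated X.
Variables (f : R -> R) (M : R).
Hypothesis densf : is_density (X 0%N) f.
Hypothesis f_le : forall x, f x <= M.
Variables (c r : R).
Hypotheses (c_ge0 : 0 <= c) (r_gt0 : 0 < r) (r_lt1 : r < 1).
Hypothesis ind_cov_le : forall k x, (0 < k)%N -> ind_cov X k x <= c * r ^+ k.
Implicit Types x : R.

Local Notation F := (distr_fun (X 0%N)).

Lemma distr_fun_dist x y : `|F x - F y| <= M * `|x - y|.
Proof.
wlog xy : x y / x <= y => [h|].
  by case: (leP x y) => [|/ltW] /h//; rewrite distrC [`|y - x|]distrC.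
rewrite distrC [`|x - y|]distrC !ger0_norm ?subr_ge0//.
  exact: (distr_fun_lip densf f_le).
exact: distr_fun_mono.
Qed.

Lemma ind_cov_dist k x y : `|ind_cov X k x - ind_cov X k y| <= 2 * M * `|x - y|.
Proof.
wlog xy : x y / x <= y => [h|].
  by case: (leP x y) => [|/ltW] /h//; rewrite distrC [`|y - x|]distrC.
apply: (le_trans (ind_cov_lip statX k xy)).
rewrite -mulrA ler_pM2l// (le_trans (ler_norm _))// distrC.
exact: distr_fun_dist.
Qed.

Lemma sigma2E x : exists2 G : R,
  sigma2 X x = (ind_cov X 0 x + 2 * G)%:E &
  forall i, 0 <= G - partial_sum (ind_cov X ^~ x) i <= c / (1 - r) * r ^+ i.
Proof.
have [G e H] := series_sum (u := ind_cov X ^~ x)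
  (fun k => ind_cov_ge0 statX assocX k x) r_gt0 r_lt1 c_ge0
  (fun k => @ind_cov_le k x).
exists G => //; rewrite /sigma2 /variance (rcovE (ind_le_Lfun2 _ _ _) (ind_le_Lfun2 _ _ _)).
rewrite (eq_eseriesr (g := fun j => (ind_cov X j x)%:E)); last first.
  by move=> j _; rewrite (rcovE (ind_le_Lfun2 _ _ _) (ind_le_Lfun2 _ _ _)).
by rewrite e -EFinM -EFinD.
Qed.

(** Moving the point from [y] to [x] changes the near covariances by a multiple
of [`|x - y|] and the distant ones by at most their bound.  At [y], by
[double_sum], the distance of the variance of the count to [n] times the limit is
twice the sum of the tails of the series of covariances. *)
Lemma count_variance_dist n m x y (G : R) :
  (forall i, 0 <= G - partial_sum (ind_cov X ^~ y) i <= c / (1 - r) * r ^+ i) ->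
  `|count_variance X n x - n%:R * (ind_cov X 0 y + 2 * G)| <=
    n%:R * ((2 * m).+1%:R * (2 * M * `|x - y|) + n%:R * (c * r ^+ m)) +
    2 * c / (1 - r) ^+ 2.
Proof.
move=> HG; have r1 : 0 < 1 - r by rewrite subr_gt0.
have M0 := density_bound_ge0 densf f_le.
rewrite (_ : _ - _ = (count_variance X n x - count_variance X n y) +
  (count_variance X n y - n%:R * (ind_cov X 0 y + 2 * G))); last by ring.
apply: (le_trans (ler_normD _ _)); apply: lerD.
  rewrite /count_variance -sumrB (le_trans (ler_norm_sum _ _ _))//.
  set B := _ + _.
  have row (i : 'I_n) : `|\sum_(j < n) ind_cov X (i - j + (j - i)) x -
      \sum_(j < n) ind_cov X (i - j + (j - i)) y| <= B.
    rewrite -sumrB (le_trans (ler_norm_sum _ _ _))// (bigID (within m i))/=.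
    apply: lerD; first apply: sum_within_le => [j _|].
    - exact: ind_cov_dist.
    - by rewrite !mulr_ge0.
    apply: sum_ord_le => [j ij|]; last by rewrite mulr_ge0// exprn_ge0// ltW.
    set k := (i - j + (j - i))%N; have mk : (m < k)%N by exact: within_far.
    have ck z : 0 <= ind_cov X k z <= c * r ^+ m.
      rewrite (ind_cov_ge0 statX assocX)/=.
      rewrite (le_trans (ind_cov_le z (leq_ltn_trans (leq0n _) mk)))//.
      rewrite ler_wpM2l// -[in leLHS](subnKC (ltnW mk)) exprD.
      rewrite ler_piMr ?exprn_ge0 ?(ltW r_gt0)//.
      by apply: exprn_ile1; exact: ltW.
    have /andP[? ?] := ck x; have /andP[? ?] := ck y.
    by rewrite ler_norml; lra.
  apply: (@le_trans _ _ (\sum_(i < n) B)); first exact: ler_sum.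
  by rewrite sumr_const card_ord mulr_natl.
rewrite /count_variance (double_sum (ind_cov X ^~ y)).
have -> : n%:R * ind_cov X 0 y + 2 * (\sum_(i < n) partial_sum (ind_cov X ^~ y) i) -
   n%:R * (ind_cov X 0 y + 2 * G) =
   - (2 * \sum_(i < n) (G - partial_sum (ind_cov X ^~ y) i)).
  by rewrite sumrB sumr_const card_ord -[_ *+ n]mulr_natl; ring.
rewrite normrN ger0_norm; last first.
  by rewrite mulr_ge0// sumr_ge0// => i _; have /andP[] := HG i.
rewrite -!mulrA ler_pM2l//.
apply: (@le_trans _ _ (\sum_(i < n) c / (1 - r) * r ^+ i)).
  by apply: ler_sum => i _; have /andP[] := HG i.
rewrite -mulr_sumr -mulrA ler_wpM2l// expr2 invfM ler_pM2l ?invr_gt0//.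
exact: geometric_sum_le.
Qed.

Variables (p x0 slope M2 eta v G : R).
Hypotheses (p_gt0 : 0 < p) (p_lt1 : p < 1) (Fx0 : F x0 = p).
Hypotheses (slope_gt0 : 0 < slope) (v_gt0 : 0 < v) (M2_ge0 : 0 <= M2).
Hypothesis expansion : forall x, `|x - x0| < eta ->
  `|F x - F x0 - slope * (x - x0)| <= M2 * (x - x0) ^+ 2.
Hypothesis v_le : forall x, `|x - x0| < eta -> v <= F x * (1 - F x).
Hypothesis G_sum : forall i,
  0 <= G - partial_sum (ind_cov X ^~ x0) i <= c / (1 - r) * r ^+ i.

Let s2 : R := ind_cov X 0 x0 + 2 * G.
Let a : R := Num.sqrt s2 / slope.

(** [quantile_normal_approx] at the point [x], then [ncdf] is Lipschitz and its
argument is compared with [t] by [standardized_shift]. *)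
Lemma local_approx n m t :
  2 <= n%:R * v ->
  n%:R ^+ 2 * (2 * m).+1%:R ^+ 2 * (c * r ^+ m) <= 1 ->
  `|t| * a / Num.sqrt n%:R < eta ->
  `|fine (P [set w | sample_quantile X n p w <= x0 + t * a / Num.sqrt n%:R])
     - ncdf t| <=
  be_const v * ((2 * m).+1%:R ^+ 2 / Num.sqrt n%:R) +
  (`|t| * ((n%:R * ((2 * m).+1%:R * (2 * M * (`|t| * a / Num.sqrt n%:R)) +
      n%:R * (c * r ^+ m)) + 2 * c / (1 - r) ^+ 2) / (n%:R * v)) +
   M2 * (t * a) ^+ 2 / (Num.sqrt n%:R * Num.sqrt v)).
Proof.
move=> nv small teta.
have n0 : 0 < n%:R :> R.
  by rewrite ltr0n lt0n; apply/negP => /eqP n0; move: nv; rewrite n0 mul0r; lra.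
have s20 : 0 <= s2.
  rewrite /s2 addr_ge0 ?(ind_cov_ge0 statX assocX)// mulr_ge0//.
  have := G_sum 0; rewrite /partial_sum big_geq// subr0 => /andP[].
  by [].
have a0 : 0 <= a by rewrite divr_ge0 ?sqrtr_ge0 ?(ltW slope_gt0).
set s := Num.sqrt n%:R; rewrite -/s in teta.
have s0 : 0 < s by rewrite sqrtr_gt0.
have sn : s ^+ 2 = n%:R by rewrite sqr_sqrtr// ltW.
set x := x0 + t * a / s.
have xx0 : x - x0 = t * a / s by rewrite /x addrC addKr.
have dx : `|x - x0| = `|t| * a / s.
  by rewrite xx0 2!normrM normfV (ger0_norm a0) (gtr0_norm s0).
have xeta : `|x - x0| < eta by rewrite dx.
have := quantile_normal_approx statX assocX c_ge0 r_gt0 r_lt1 ind_cov_le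
  p_gt0 p_lt1 v_gt0 (v_le xeta) nv small.
rewrite -/s; set z := _ / Num.sqrt (count_variance X n x) => hz.
set Pq := fine _ in hz *.
rewrite (_ : Pq - ncdf t = (Pq - ncdf z) + (ncdf z - ncdf t)); last by ring.
rewrite (le_trans (ler_normD _ _))// lerD//.
rewrite (le_trans (ncdf_lip _ _))//.
pose e := n%:R * (F x - F x0 - slope * (x - x0)).
have ez : z = (t * (s * Num.sqrt s2) + e) / Num.sqrt (count_variance X n x).
  rewrite /z; congr (_ / _); rewrite /e Fx0 xx0 -sn /a.
  by field; rewrite !gt_eqF.
have eE : `|e| <= M2 * (t * a) ^+ 2.
  rewrite /e normrM (gtr0_norm n0).
  apply: (le_trans (ler_wpM2l (ltW n0) (expansion xeta))).
  by rewrite xx0 expr_div_n sn; rewrite le_eqVlt; apply/orP; left; apply/eqP;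
    field; rewrite gt_eqF.
have Vge := count_variance_ge statX assocX n (v_le xeta).
have := count_variance_dist n m x G_sum; rewrite -/s2 dx => VB.
by rewrite ez; exact: (standardized_shift t n0 v_gt0 s20 Vge VB eE).
Qed.

Variables (b l : R) (n : nat).
Hypotheses (b_gt0 : 0 < b) (rE : r = expR (- b)) (nE : n%:R = expR l).
Hypothesis a_gt0 : 0 < a.
Let K : R := 10 / b + 3.
Hypotheses (l_ge1 : 1 <= l) (c_le : c <= l) (K_le : 256 * K <= l).
Hypotheses (v_le_l : 2 / v <= l) (eta_le : 256 * a ^+ 2 / eta ^+ 2 <= l).
Hypothesis eta_gt0 : 0 < eta.

Local Notation s := (Num.sqrt (n%:R : R)).
Local Notation c2 := (2 * c / (1 - r) ^+ 2).

Definition rate_const : R :=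
  be_const v * K ^+ 2 + (2 * M * a * K + 1 + c2) / v + M2 * a ^+ 2 / Num.sqrt v.

Local Notation Pq t :=
  (fine (P [set w | sample_quantile X n p w <= x0 + t * a / s])).

Lemma sqrt_size : s = expR (l / 2).
Proof.
rewrite nE (_ : expR l = expR (l / 2) ^+ 2).
  by rewrite sqrtr_sqr ger0_norm ?expR_ge0.
by rewrite -expRM_natl; congr expR; field.
Qed.

Lemma sqrt_size_gt0 : 0 < s.
Proof. by rewrite sqrt_size expR_gt0. Qed.

Lemma size_gt0 : (0 < n)%N.
Proof. by rewrite -(ltr0n R) nE expR_gt0. Qed.

Lemma log_le_size : l <= n%:R.
Proof. by rewrite nE; have := expR_ge1Dx l; lra. Qed.

Lemma inv_sqrt_size_le : s^-1 <= l ^+ 2 / s.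
Proof. by rewrite ler_peMl ?invr_ge0 ?(ltW sqrt_size_gt0)// exprn_ege1. Qed.

Lemma shift_small t : t ^+ 2 <= l -> `|t| * a / s < eta.
Proof.
have s0 := sqrt_size_gt0; have n0 : 0 < n%:R :> R by rewrite ltr0n size_gt0.
have l0 : 0 <= l by exact: le_trans l_ge1.
have sn : s ^+ 2 = n%:R by rewrite sqr_sqrtr// ltW.
move=> tl; rewrite -(@ltr_pXn2r _ 2) ?nnegrE ?(ltW eta_gt0)//; last first.
  by apply: divr_ge0; [apply: mulr_ge0 => //; exact: ltW|exact: ltW].
rewrite expr_div_n sn exprMn (real_normK (num_real t)) ltr_pdivrMr//.
have e2 : 0 < eta ^+ 2 by rewrite exprn_gt0.
have el' : 256 * a ^+ 2 <= l * eta ^+ 2 by rewrite -ler_pdivrMr.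
have q : (l / 4) ^+ 4 < n%:R by rewrite nE quartic_lt_exp.
apply: (@le_lt_trans _ _ (eta ^+ 2 * (l / 4) ^+ 4)); last by rewrite ltr_pM2l.
rewrite (_ : eta ^+ 2 * (l / 4) ^+ 4 =
  l * ((l * eta ^+ 2) / 256 * l ^+ 2)); last by field.
apply: ler_pM => //; first exact: sqr_ge0.
  by rewrite mulr_ge0// ltW.
apply: (@le_trans _ _ (a ^+ 2 * 1)); first by rewrite mulr1.
apply: ler_pM => //; [exact: sqr_ge0| |exact: exprn_ege1].
by move: el'; move: (a ^+ 2) (l * eta ^+ 2) => u w; lra.
Qed.

Lemma central_rate t : t ^+ 2 <= l -> `|Pq t - ncdf t| <= rate_const * (l ^+ 2 / s).
Proof.
move=> tl; have r0 := r_gt0.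
have l0 : 0 <= l by exact: le_trans l_ge1.
have n0 : 0 < n%:R :> R by rewrite ltr0n size_gt0.
have nv : 2 <= n%:R * v by rewrite -ler_pdivrMr//; exact: le_trans log_le_size.
have [m [LK small]] := window_exists b_gt0 c_ge0 nE l_ge1 c_le K_le.
rewrite -rE in small.
apply: (le_trans (local_approx nv small (shift_small tl))).
apply: rate_bound => //.
- by rewrite sqr_sqrtr// ltW.
- by rewrite sqrt_size -expR0 ler_expR divr_ge0.
- exact: density_bound_ge0 densf f_le.
- exact: ltW.
- by apply: divr_ge0; [exact: mulr_ge0|exact: sqr_ge0].
- by rewrite mulr_ge0// exprn_ge0// ltW.
- exact: be_const_ge0.
apply: le_trans small; rewrite ler_wpM2r ?mulr_ge0 ?exprn_ge0 ?(ltW r0)//.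
by rewrite ler_peMr ?sqr_ge0// exprn_ege1// ler1n.
Qed.

(** Outside the window of radius [sqrt l] both distribution functions are within
the target accuracy of their limits, since the Gaussian tail there is at most a
multiple of [expR (- l / 2)], the inverse square root of the sample size. *)
Lemma uniform_rate t :
  `|Pq t - ncdf t| <= (rate_const + tail_bound R) * (l ^+ 2 / s).
Proof.
have l0 : 0 <= l by exact: le_trans l_ge1.
have s0 := sqrt_size_gt0.
have tb0 : 0 <= tail_bound R by rewrite invr_ge0 ltW// phi_gt0.
have mQ x := measurable_sample_quantile X x size_gt0 p_gt0 p_lt1.
have monoP u u' : u <= u' -> Pq u <= Pq u'.
  move=> uu'; rewrite fine_le ?fin_num_measure//.
  apply: le_measure; rewrite ?inE// => w /= /le_trans; apply.
  by rewrite lerD2l ler_pM2r ?invr_gt0// ler_pM2r.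
have P01 u : 0 <= Pq u <= 1.
  rewrite fine_ge0//= -[leRHS]/(fine 1%:E) fine_le ?fin_num_measure//.
  exact: probability_le1.
set Tl := Num.sqrt l; have Tl0 : 0 <= Tl by exact: sqrtr_ge0.
have Tl2 : Tl ^+ 2 = l by rewrite sqr_sqrtr.
have tailphi : tail_bound R * phi Tl <= tail_bound R * (l ^+ 2 / s).
  rewrite ler_wpM2l// (le_trans (phi_leexp Tl))// (le_trans _ inv_sqrt_size_le)//.
  by rewrite sqrt_size Tl2 -expRN mulNr.
have up : 1 - ncdf Tl <= tail_bound R * (l ^+ 2 / s).
  apply: le_trans tailphi.
  exact: (tail_ratio (@is_derive_uppertail R) (@uppertail_cvg0 R) (@uppertail_le1 R)).
have lo : ncdf (- Tl) <= tail_bound R * (l ^+ 2 / s).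
  apply: le_trans tailphi.
  exact: (tail_ratio (@is_derive_lowertail R) (@lowertail_cvg0 R) (@lowertail_le1 R)).
set A := rate_const * (l ^+ 2 / s); set B := tail_bound R * (l ^+ 2 / s) in up lo *.
have inT : `|Pq Tl - ncdf Tl| <= A by rewrite central_rate// Tl2.
have inN : `|Pq (- Tl) - ncdf (- Tl)| <= A by rewrite central_rate// sqrrN Tl2.
have A0 : 0 <= A := le_trans (normr_ge0 _) inT.
rewrite ler_distl in inT; rewrite ler_distl in inN.
have /andP[inT1 inT2] := inT; have /andP[inN1 inN2] := inN.
have /andP[P0 P1] := P01 t; have n01 := ncdf_ge0 t; have n11 := ncdf_le1 t.
rewrite mulrDl -/A -/B; case: (leP (t ^+ 2) l) => [tl|].
  apply: (le_trans (central_rate tl)); rewrite -/A lerDl mulr_ge0//.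
  by rewrite (le_trans _ inv_sqrt_size_le)// invr_ge0 ltW.
rewrite -Tl2 => Tt.
rewrite ler_norml; case: (leP 0 t) => t0.
  have tT : Tl <= t by rewrite ltW// -(@ltr_pXn2r _ 2) ?nnegrE.
  have := monoP _ _ tT; have := ncdf_le tT => ? ?; apply/andP; split; lra.
have tT : t <= - Tl.
  by rewrite lerNr ltW// -(@ltr_pXn2r _ 2) ?nnegrE ?oppr_ge0 ?(ltW t0)// sqrrN.
have := monoP _ _ tT; have := ncdf_le tT => ? ?; apply/andP; split; lra.
Qed.

End VarianceComparison.

(** * The theorem *)

Lemma sum_ge_terms (R : realType) (u1 u2 u3 u4 : R) :
  0 <= u1 -> 0 <= u2 -> 0 <= u3 -> 0 <= u4 ->
  let u := 1 + u1 + u2 + u3 + u4 in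
  [/\ 1 <= u, u2 <= u, u1 <= u, u3 <= u & u4 <= u].
Proof. by move=> ? ? ? ? /=; split; lra. Qed.

Theorem theorem1 (d : measure_display) (T : measurableType d) (R : realType)
  (P : probability T R) (X : nat -> {RV P >-> R}) (p : R) (f : R -> R)
  (stationaryX : strictly_stationary X)
  (associatedX : associated X)
  (second_moment : forall i, (X i : T -> R) \in Lfun P 2%:E)
  (p_gt0 : 0 < p) (p_lt1 : p < 1) :
  let F := distr_fun (X 0%N) in
  let xp := quantile F p in
  let ap := sigma X xp / f xp in
  is_density (X 0%N) f ->
  (exists M : R, forall x, f x <= M) ->
  bounded_second_derivative_near F xp ->
  (\forall x \near xp, f x = F^`()%classic x) ->
  (exists a0 a : R, [/\ 0 <= a0, 0 < a &
     forall k : nat, (1 <= k)%N ->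
       (covariance P (X 0%N) (X k) <= (a0 * expR (- a * k%:R))%:E)%E]) ->
  0 < f xp ->
  exists C : R, \forall n \near \oo,
    (ereal_sup (range (fun t : R =>
       `| P [set w | (Num.sqrt n%:R * (sample_quantile X n p w - xp) / ap <= t)%R]
          - Phi t |)) <= (C * (Num.sqrt n%:R)^-1 * ln n%:R ^+ 2)%:E)%E.
Proof.
move=> F xp ap densf [M fM] bsd nearf [a0 [a [a00 a_gt0 covX]]] fxp.
have M0 : 0 <= M by exact: density_bound_ge0 densf fM.
pose b := a / 3; pose c := a0 + 2 * M; pose r := expR (- b).
have b0 : 0 < b by rewrite divr_gt0.
have c0 : 0 <= c by rewrite addr_ge0// mulr_ge0.
have r0 : 0 < r by exact: expR_gt0.
have r1 : r < 1 by rewrite -expR0 ltr_expR oppr_lt0.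
have covle k x : (0 < k)%N -> ind_cov X k x <= c * r ^+ k.
  move=> k0.
  have -> : r ^+ k = expR (- (a / 3) * k%:R) by rewrite /r -expRM_natl mulrC.
  exact: (ind_cov_decay stationaryX associatedX second_moment densf fM _ k0
    (covX k k0)).
have Fxp : F xp = p.
  apply: (@quantile_lip _ _ _ M) => //.
  - by move=> x y; exact: distr_fun_mono.
  - exact: distr_fun_lip densf fM.
  - have [y hy] := @distr_fun_cvg1 _ _ _ _ (X 0%N) (1 - p) ltac:(by rewrite subr_gt0).
    by exists y; rewrite /F; lra.
  - have [y hy] := @distr_fun_cvg0 _ _ _ _ (X 0%N) (p / 2) ltac:(by rewrite divr_gt0).
    by exists y; rewrite /F; lra.
have [M2 [eta1 [M20 eta10 expand]]] := second_order_expansion bsd.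
rewrite -(nbhs_singleton nearf) in expand.
pose pq := p * (1 - p); have pq0 : 0 < pq by rewrite mulr_gt0// subr_gt0.
(* [p / 2 <= F x] and [(1 - p) / 2 <= 1 - F x] near [xp] *)
pose v := pq / 4; have v0 : 0 < v by rewrite divr_gt0.
pose eta := Num.min eta1 (pq / (2 * (M + 1))).
have M1 : 0 < M + 1 by rewrite ltr_wpDl.
have eta0 : 0 < eta by rewrite lt_min eta10/= divr_gt0// mulr_gt0.
have {}expand x : `|x - xp| < eta ->
    `|F x - F xp - f xp * (x - xp)| <= M2 * (x - xp) ^+ 2.
  by rewrite lt_min => /andP[? _]; exact: expand.
have vle x : `|x - xp| < eta -> v <= F x * (1 - F x).
  rewrite lt_min => /andP[_]; rewrite ltr_pdivlMr ?mulr_gt0// => xx.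
  have Fd : `|F x - p| <= pq / 2.
    have := distr_fun_dist densf fM x xp; rewrite -/F Fxp => /le_trans; apply.
    have := normr_ge0 (x - xp); nra.
  have Fp : p / 2 <= F x.
    by move: Fd; rewrite ler_norml /pq => /andP[? ?]; nra.
  have Fq : (1 - p) / 2 <= 1 - F x.
    by move: Fd; rewrite ler_norml /pq => /andP[? ?]; nra.
  rewrite /v /pq (_ : _ / 4 = p / 2 * ((1 - p) / 2)); last by field.
  by apply: ler_pM => //; rewrite divr_ge0 ?subr_ge0 ?(ltW p_gt0) ?(ltW p_lt1).
have [G sG HG] := sigma2E stationaryX associatedX c0 r0 r1 covle xp.
pose s2 := ind_cov X 0 xp + 2 * G.
have G0 : 0 <= G.
  by have := HG 0%N; rewrite /partial_sum big_geq// subr0 => /andP[].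
have s20 : 0 < s2.
  by rewrite /s2 (ind_cov0 stationaryX) -/F Fxp -/pq ltr_wpDr// mulr_ge0.
have apE : ap = Num.sqrt s2 / f xp by rewrite /ap /sigma sG.
have ap0 : 0 < Num.sqrt s2 / f xp by rewrite divr_gt0// sqrtr_gt0.
pose K := 10 / b + 3.
have K0 : 0 <= 256 * K.
  exact: (mulr_ge0 (ler0n R 256)
    (addr_ge0 (divr_ge0 (ler0n R 10) (ltW b0)) (ler0n R 3))).
have v20 : 0 <= 2 / v := divr_ge0 (ler0n R 2) (ltW v0).
have e0 : 0 <= 256 * (Num.sqrt s2 / f xp) ^+ 2 / eta ^+ 2.
  exact: (divr_ge0 (mulr_ge0 (ler0n R 256) (sqr_ge0 _)) (sqr_ge0 _)).
exists (rate_const X M c r xp (f xp) M2 v G b + tail_bound R).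
pose l0 := 1 + 256 * K + c + 2 / v +
  256 * (Num.sqrt s2 / f xp) ^+ 2 / eta ^+ 2.
have [l1 cl Kl vl el] : [/\ 1 <= l0, c <= l0, 256 * K <= l0, 2 / v <= l0 &
    256 * (Num.sqrt s2 / f xp) ^+ 2 / eta ^+ 2 <= l0].
  exact: sum_ge_terms.
near=> n.
have nl0 : expR l0 <= n%:R by near: n; exact: nbhs_infty_ger.
have n0 : 0 < n%:R :> R by apply: lt_le_trans nl0; exact: expR_gt0.
have ll0 : l0 <= ln n%:R by rewrite -ler_expR lnK.
have nE : n%:R = expR (ln n%:R) :> R by rewrite lnK.
have s0 : 0 < Num.sqrt (n%:R : R) by rewrite sqrtr_gt0.
apply: ub_ereal_sup => _ [t _ <-].
have -> : [set w | (Num.sqrt n%:R * (sample_quantile X n p w - xp) / ap <= t)%R] =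
    [set w | sample_quantile X n p w <=
       xp + t * (Num.sqrt s2 / f xp) / Num.sqrt n%:R].
  have key q : (Num.sqrt n%:R * (q - xp) / ap <= t) =
      (q <= xp + t * (Num.sqrt s2 / f xp) / Num.sqrt n%:R).
    by rewrite apE ler_pdivrMr// [_ * (q - xp)]mulrC -ler_pdivlMr// lerBlDl.
  by apply/seteqP; split => w /=; rewrite key.
rewrite PhiE -(fineK (_ : P _ \is a fin_num)) ?fin_num_measure//; last first.
  by apply: measurable_sample_quantile => //; rewrite -(ltr0n R).
rewrite -EFinB abse_EFin lee_fin -[leRHS]mulrA [X in _ <= _ * X]mulrC.
apply: (uniform_rate stationaryX associatedX densf fM c0 r0 r1 covle p_gt0
  p_lt1 Fxp fxp v0 M20 expand vle HG b0 erefl nE ap0) => //; exact: le_trans ll0.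
Unshelve. all: by end_near.
Qed.
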